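(* Let $k\ge 2$ be fixed, $N=kn$, and let $m=p\binom{N}{2}$ be an integer with $m=\Omega(\binom{N}{2}/\log n)$. Let $G$ be a uniformly random connected graph on $N$ labeled vertices with $m$ edges, and let $T$ be a uniformly random spanning tree of $G$. Then the probability that $T$ is $k$-splittable is at least $C_k\, n^{\frac{1-k}{2}}\, p\, e^{-(2+o(1))/p}$, where $C_k>0$ depends only on $k$ and $o(1)\to 0$ as $n\to\infty$; in particular it is at least $C_k n^{-\frac k2-O(1)}$.
   Context: A tree $T$ is $k$-splittable if there exist $k-1$ edges of $T$ whose removal leaves a forest whose $k$ connected components all have the same number of vertices. The probability is taken over both $G$ and $T$, i.e. it equals $\mathbb{E}_G[\tau_k(G)/\tau(G)]$, where $\tau(G)$ is the number of spanning trees of $G$ and $\tau_k(G)$ the number of $k$-splittable spanning trees of $G$. *)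

(* Defs.v *)
From HB Require Import structures.
From mathcomp Require Import all_boot all_order all_algebra.
From mathcomp Require Import all_classical all_reals all_analysis.
Set Implicit Arguments. Unset Strict Implicit. Unset Printing Implicit Defensive.
Import Order.TTheory GRing.Theory Num.Theory.

(* A graph on the labeled vertex set 'I_N is given by its edge set:
   a set of 2-element subsets of 'I_N. *)
Definition graph (N : nat) := {set {set 'I_N}}.

Definition simple_graph N (E : graph N) : bool := [forall e in E, #|e| == 2].

Definition adj N (E : graph N) : rel 'I_N := fun x y => [set x; y] \in E.

Definition gconnected N (E : graph N) : bool :=
  [forall x, forall y, connect (adj E) x y].

(* tree on all N vertices: connected and acyclic, acyclicity expressed as
   "every edge is a bridge" (removing it disconnects the graph). *)
Definition is_tree N (E : graph N) : bool :=
  [&& simple_graph E, gconnected E & [forall e in E, ~~ gconnected (E :\ e)]].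

Definition component N (E : graph N) (v : 'I_N) : {set 'I_N} :=
  [set w | connect (adj E) v w].

Definition k_splittable N (k : nat) (T : graph N) : bool :=
  [exists S : graph N,
    [&& S \subset T, #|S| == k.-1,
        #|[set component (T :\: S) v | v : 'I_N]| == k &
        [forall u, forall v,
           #|component (T :\: S) u| == #|component (T :\: S) v|]]].

Definition spanning_trees N (E : graph N) : {set graph N} :=
  [set T in powerset E | is_tree T].

Definition tau N (E : graph N) : nat := #|spanning_trees E|.

Definition tau_k N (k : nat) (E : graph N) : nat :=
  #|[set T in spanning_trees E | k_splittable k T]|.

Definition connected_graphs N (m : nat) : {set graph N} :=
  [set E : graph N | [&& simple_graph E, #|E| == m & gconnected E]].

(* P(T is k-splittable) = E_G [tau_k(G)/tau(G)], G uniform connected with m edges *)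
Definition prob_split (R : realType) (N k m : nat) : R :=
  (#|connected_graphs N m|%:R)^-1 *
  \sum_(E in connected_graphs N m) ((tau_k k E)%:R / (tau E)%:R).

(* Main.v *)
Require Import Defs.
From HB Require Import structures.
From mathcomp Require Import all_boot all_order all_algebra all_fingroup.
From mathcomp Require Import ring lra zify.
Import Order.TTheory GRing.Theory Num.Theory.
Set Implicit Arguments. Unset Strict Implicit. Unset Printing Implicit Defensive.
Local Open Scope ring_scope.

(** Write [N = k n], [M = C(N, 2)], and let [A] be the set of [k]-splittable trees
    of the complete graph. Summing [1 / tau >= 2 l - l^2 tau] against [tau_k] over all
    connected graphs with [m] edges bounds the probability below by [|A| / W], where
    [W] bounds [sum_T' x^|T cap T'|] over all trees [T'], uniformly in [T], with
    [x = M / (m - N)]: containment of [T cup T'] in a random graph costs at most a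
    factor [x] per common edge compared with independence. No estimate of the number
    of connected graphs is needed, since graphs containing a tree are connected.

    A rooted forest is a self-map whose only cycles are its fixed points, and the
    weighted count of such maps is a determinant. For the weights [x] on [T] and [1]
    elsewhere this determinant factors as an explicit one times the one of
    [(N + 1) + (x - 1) L_T]; dropping acyclicity bounds the latter by the product of
    its row weights, so that [W = N^(N-2) e^(2 x)]. For unit weights the determinant
    gives Cayley's formula. Attaching [k - 1] rooted trees on [n] vertices to a further
    one gives [|A| >= C N! / (n!)^k n^(N-2)], and the multinomial coefficient is at
    least [C k^N n^((1-k)/2)]. *)

(** * Rooted forests and determinants *)

(** Every orbit ends in a fixed point. An orbit that reaches one does so within [#|T|] steps, so
    testing this single iterate makes the property boolean. *)
Definition forestf (T : finType) (g : T -> T) : bool :=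
  [forall v, g (iter #|T| g v) == iter #|T| g v].

Lemma iter_fix_ge (T : finType) (g : T -> T) v t u : (t <= u)%N ->
  g (iter t g v) = iter t g v -> iter u g v = iter t g v.
Proof.
move=> /subnK <- gt; elim: (u - t)%N => //= d IH.
by rewrite -/(iter (d + t) g v) IH.
Qed.

Lemma iter_card_fix (T : finType) (g : T -> T) v t :
  g (iter t g v) = iter t g v -> g (iter #|T| g v) = iter #|T| g v.
Proof.
move=> gt; set y := iter t g v in gt.
have vy : fconnect g v y by apply: fconnect_iter.
have lt : (findex g v y <= #|T|)%N.
  by apply: leq_trans (ltnW (findex_max vy)) (max_card _).
by rewrite (iter_fix_ge lt) iter_findex.
Qed.

Lemma forestfP (T : finType) (g : T -> T) :
  reflect (forall v, exists t, g (iter t g v) = iter t g v) (forestf g).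
Proof.
apply: (iffP forallP) => [gf v|gf v]; first by exists #|T|; apply/eqP.
by have [t gt] := gf v; apply/eqP/(iter_card_fix gt).
Qed.

Lemma forestf_measure (T : finType) (g : T -> T) (d : T -> nat) :
  (forall v, g v != v -> (d (g v) < d v)%N) -> forestf g.
Proof.
move=> dg; apply/forestfP => v.
elim: {v}(d v).+1 {-2}v (ltnSn (d v)) => // m IH v vm.
case: (eqVneq (g v) v) => [gv|gv]; first by exists 0%N.
have [t gt] := IH (g v) (leq_trans (dg v gv) vm).
by exists t.+1; rewrite iterSr.
Qed.

(** A returning orbit is periodic, yet eventually constant; the index [u * t.+1] is both a multiple
    of the period and past the moment of stabilisation. *)
Lemma forestf_no_cycle (T : finType) (g : T -> T) v t : forestf g ->
  iter t.+1 g v = v -> g v = v.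
Proof.
move=> /forestfP /(_ v) [u gu] cyc.
have per m : iter (m * t.+1) g v = v.
  by elim: m => // m IH; rewrite mulSn iterD IH.
have := @iter_fix_ge _ g v u (u * t.+1)%N (leq_pmulr _ _) gu.
by rewrite // per => /(_ isT) vE; rewrite [in LHS]vE gu -vE.
Qed.

(** The Laplacian of the functional graph of [g], with 1 on the whole diagonal: a root contributes a
    row of the identity. *)
Definition forest_mx (R : idomainType) n (g : 'I_n -> 'I_n) : 'M[R]_n :=
  \matrix_(i, j) ((i == j)%:R - ((g i != i) && (g i == j))%:R).

(** For a forest only the identity permutation survives in the Leibniz formula: any other nonzero
    term would follow [g] around a cycle. Otherwise the indicator of the vertices whose orbit never
    becomes constant lies in the kernel. *)
Lemma det_forest_mx (R : idomainType) n (g : 'I_n -> 'I_n) :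
  \det (forest_mx R g) = (forestf g)%:R.
Proof.
case: (boolP (forestf g)) => [gf|/forallPn[v0 v0P]].
  rewrite /determinant (bigD1 1%g) //= odd_perm1 expr0 mul1r.
  rewrite big1 => [|i _]; last first.
    by rewrite mxE perm1 eqxx andNb subr0.
  rewrite big1 ?addr0 // => s s1; apply/eqP; rewrite mulf_eq0; apply/orP; right.
  apply/negPn; apply/negP => /prodf_neq0 nz.
  have sE i : s i != i -> s i = g i.
    move=> si; have := nz i isT; rewrite mxE (eq_sym i) (negPf si) sub0r oppr_eq0.
    by case: andP => [[_ /eqP->]//|]; rewrite eqxx.
  have [i si] : exists i, s i != i.
    apply/existsP; rewrite -negb_forall; apply: contra s1 => /forallP sid.
    by apply/eqP/permP => i; rewrite perm1; apply/eqP.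
  have it t : iter t s i = iter t g i /\ s (iter t s i) != iter t s i.
    elim: t => // t [IH nf]; split; first by rewrite /= sE // IH.
    by rewrite /= (inj_eq perm_inj).
  have /forestfP/(_ i) [t gt] := gf; have [e nf] := it t.
  by move: (nf); rewrite sE // e gt eqxx.
rewrite -det_tr; apply/eqP/det0P.
pose bad i := g (iter n g i) != iter n g i.
have fixbad i : bad i -> g i != i.
  by apply: contra => /eqP gi; rewrite (@iter_fix_ge _ g i 0) //= gi.
have badg i : bad (g i) = bad i.
  rewrite /bad -iterSr /=; congr (~~ _); apply/eqP/eqP => [e|e]; last by rewrite e.
  by have := @iter_card_fix _ g i n.+1 e; rewrite card_ord.
exists (\row_i (bad i)%:R).
  apply: contraNneq v0P => /rowP/(_ v0); rewrite !mxE /bad card_ord.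
  by case: eqP => // _ /eqP; rewrite oner_eq0.
apply/rowP => i; rewrite !mxE (bigD1 i) //= !mxE eqxx.
case: (eqVneq (g i) i) => [gi|gi] /=.
  rewrite (negPf (_ : ~~ bad i)); last by apply/negP => /fixbad; rewrite gi eqxx.
  rewrite mul0r add0r big1 // => j ji; rewrite !mxE gi eqxx /= (eq_sym i) (negPf ji).
  by rewrite subr0 mulr0.
rewrite subr0 mulr1 (bigD1 (g i)) //= !mxE gi eqxx /= (eq_sym i) (negPf gi) badg.
rewrite sub0r mulrN1 addrA subrr add0r big1 // => j /andP[ji jg].
by rewrite !mxE (eq_sym i) (negPf ji) gi (eq_sym (g i)) (negPf jg) subr0 mulr0.
Qed.

(* The directed matrix-tree theorem: a root is a fixed point of [g], and
   [w i i] is the weight of choosing [i] as a root. *)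
Lemma det_laplacian (R : idomainType) n (w : 'I_n -> 'I_n -> R) :
  \det (\matrix_(i, j) ((i == j)%:R * (\sum_l w i l) - (i != j)%:R * w i j))
    = \sum_(g : {ffun 'I_n -> 'I_n} | forestf g) \prod_i w i (g i).
Proof.
(* Row [i] of the matrix is the combination of the rows [B i l] with weights [w i l]. By
   multilinearity the determinant is a sum over the choices [g] of one [l] per row, each choice
   giving [forest_mx R g]. *)
pose B (i l j : 'I_n) : R := (i == j)%:R - ((l != i) && (l == j))%:R.
transitivity (\det (\matrix_(i, j < n) \sum_l w i l * B i l j)).
  congr (\det _); apply/matrixP => i j; rewrite !mxE /B.
  under [RHS]eq_bigr do rewrite mulrBr.
  rewrite sumrB -mulr_suml [X in _ = X - _]mulrC; congr (_ - _).
  rewrite (bigD1 j) //= eqxx andbT (eq_sym j) mulrC big1 ?addr0 // => l lj.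
  by rewrite (negPf lj) andbF mulr0.
rewrite /determinant.
under eq_bigr => s _.
  under eq_bigr => i _ do rewrite mxE.
  rewrite bigA_distr_bigA /= big_distrr /=; over.
rewrite exchange_big /= [RHS]big_mkcond; apply: eq_bigr => g _.
transitivity ((\prod_i w i (g i)) * \det (forest_mx R g)).
  rewrite /determinant big_distrr /=; apply: eq_bigr => s _.
  rewrite big_split /= mulrCA; congr (_ * (_ * _)).
  by apply: eq_bigr => i _; rewrite mxE.
by rewrite det_forest_mx; case: ifP; rewrite ?mulr1 ?mulr0.
Qed.

(** The determinant of the bordered matrix [X] is computed by eliminating from the left and from the
    right. The right multiplier has determinant [a], which stands in for a division and is cancelled
    at the start. *)
Lemma det_scalar_sub_const (R : idomainType) n (a : R) : a != 0 ->
  \det (a%:M - const_mx 1 : 'M[R]_n.+1) = a ^+ n * (a - n.+1%:R).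
Proof.
move=> a0; apply: (mulfI a0).
pose u : 'M[R]_(1, n.+1) := const_mx 1; pose v : 'M[R]_(n.+1, 1) := const_mx 1.
pose X : 'M[R]_(1 + n.+1) := block_mx 1%:M u v a%:M.
have vu : v *m u = const_mx 1.
  by apply/matrixP => i j; rewrite !mxE big_ord1 !mxE mulr1.
have uv : u *m v = n.+1%:R%:M.
  apply/matrixP => i j; rewrite !mxE !ord1 eqxx mulr1n.
  by under eq_bigr do rewrite !mxE mulr1; rewrite sumr_const card_ord.
have X1 : \det X = \det (a%:M - const_mx 1 : 'M[R]_n.+1).
  have := det_mulmx (block_mx 1%:M 0 (- v) 1%:M) X.
  rewrite mulmx_block !mul1mx !mul0mx !addr0 mulmx1 addNr mulNmx vu addrC.
  by rewrite det_lblock !det1 !mul1r det_ublock det1 mul1r.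
have := det_mulmx X (block_mx a%:M 0 (- v) 1%:M).
rewrite mulmx_block !mulmx0 !mulmx1 !mul1mx add0r mulmxN uv.
rewrite mulmxN mul_scalar_mx mul_mx_scalar subrr add0r.
rewrite det_ublock det_lblock det1 mulr1 -raddfB !det_scalar expr1 X1 => e.
by rewrite mulrC -e exprS; ring.
Qed.

Definition fixedpts (T : finType) (g : T -> T) : {set T} := [set v | g v == v].

(** Cayley's formula: when each root is marked by ['X], the forest sum is
    [('X + n.+1%:R) ^+ n * 'X], and its coefficient of degree 1 counts the forests with one root. *)
Lemma card_rooted_trees n :
  #|[set g : {ffun 'I_n.+1 -> 'I_n.+1} | forestf g & #|fixedpts g| == 1%N]|
    = (n.+1 ^ n)%N.
Proof.
pose w (i j : 'I_n.+1) : {poly int} := if i == j then 'X else 1.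
have := det_laplacian w.
have -> : \matrix_(i, j) ((i == j)%:R * (\sum_l w i l) - (i != j)%:R * w i j)
    = ('X + n.+1%:R)%:M - const_mx 1.
  apply/matrixP => i j; rewrite !mxE; case: (eqVneq i j) => [<-|ij] /=.
    rewrite mul1r mul0r subr0 mulr1n (bigD1 i) //= {1}/w eqxx.
    rewrite (eq_bigr (fun=> 1)) => [|l li]; last by rewrite /w eq_sym (negPf li).
    rewrite sumr_const cardC1 card_ord /= -natr1; ring.
  by rewrite mul0r mul1r mulr0n /w (negPf ij).
rewrite det_scalar_sub_const; last first.
  by rewrite -polyC_natr -size_poly_eq0 size_XaddC.
rewrite addrK => /(congr1 (coefp 1)) /=.
rewrite coefMX /= coef_sum.
under eq_bigr => g gf.
  rewrite (_ : \prod_i w i (g i) = 'X ^+ #|fixedpts g|); last first.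
    rewrite (bigID (mem (fixedpts g))) /= [X in _ * X]big1 ?mulr1; last first.
      by move=> i; rewrite inE /w eq_sym => /negPf->.
    rewrite (eq_bigr (fun=> 'X)) ?prodr_const //.
    by move=> i; rewrite inE /w eq_sym => ->.
  rewrite coefXn; over.
rewrite -horner_coef0 horner_exp hornerD hornerX -polyC_natr hornerC add0r.
rewrite -natrX -natr_sum => /eqP; rewrite eqr_nat => /eqP ->.
rewrite -sum1_card [LHS]big_mkcond [RHS]big_mkcond; apply: eq_bigr => g _.
by rewrite inE; case: forestf => //=; rewrite eq_sym; case: eqP.
Qed.

(** * Trees as rooted functions *)

Lemma set2_eq (T : finType) (a b c d : T) : [set a; b] = [set c; d] ->
  (a = c /\ b = d) \/ (a = d /\ b = c).
Proof.
move/setP => e; move: (e a) (e b) (e c) (e d); rewrite !inE !eqxx ?orbT /=.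
rewrite (eq_sym c a) (eq_sym c b) (eq_sym d a) (eq_sym d b).
case: (eqVneq a c) => [ac|_]; case: (eqVneq a d) => [ad|_];
  case: (eqVneq b c) => [bc|_]; case: (eqVneq b d) => [bd|_] //= *; subst;
  by auto.
Qed.

Definition rt (T : finType) (g : T -> T) v := iter #|T| g v.

Lemma rt_fix (T : finType) (g : T -> T) v : forestf g -> g (rt g v) = rt g v.
Proof. by move/forallP/(_ v)/eqP. Qed.

Lemma rt_step (T : finType) (g : T -> T) v : forestf g -> rt g (g v) = rt g v.
Proof. by move=> gf; rewrite -[RHS](rt_fix v gf) /rt -iterSr. Qed.

Lemma rt_id (T : finType) (g : T -> T) v : g v = v -> rt g v = v.
Proof. by move=> gv; rewrite /rt (@iter_fix_ge _ g v 0). Qed.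

Definition fedges N (g : 'I_N -> 'I_N) : graph N :=
  [set [set i; g i] | i in [pred i | g i != i]].

(** Two distinct vertices producing the same edge would form a cycle of length 2. Hence the edges of
    a forest correspond to its non-roots. *)
Lemma fedges_inj N (g : 'I_N -> 'I_N) i j : forestf g -> g i != i ->
  [set i; g i] = [set j; g j] -> i = j.
Proof.
move=> gf gi /set2_eq [[]//|[e1 e2]]; case/eqP: gi.
by apply: (@forestf_no_cycle _ g i 1) => //=; rewrite e2 -e1.
Qed.

Lemma card_fedges N (g : 'I_N -> 'I_N) : forestf g ->
  (#|fedges g| + #|fixedpts g| = N)%N.
Proof.
move=> gf; rewrite /fedges card_in_imset => [|i j gi _]; last exact: fedges_inj.
rewrite -[RHS]card_ord -(cardC (mem (fixedpts g))) addnC; congr (_ + _)%N.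
by apply: eq_card => i; rewrite !inE.
Qed.

Lemma adj_sym N (E : graph N) : symmetric (adj E).
Proof. by move=> x y; rewrite /adj setUC. Qed.

Lemma adj_fedges N (g : 'I_N -> 'I_N) i j : adj (fedges g) i j ->
  g i = j \/ g j = i.
Proof.
by case/imsetP => l _ /set2_eq [[-> ->]|[-> ->]]; auto.
Qed.

(** An edge joins a vertex to its parent, so it preserves the root; conversely, two vertices with
    the same root both climb to it. *)
Lemma connect_fedges N (g : 'I_N -> 'I_N) v w : forestf g ->
  connect (adj (fedges g)) v w = (rt g v == rt g w).
Proof.
move=> gf; apply/idP/eqP => [/connectP[p]|e].
  elim: p v => [v _ -> //|u p IH v /= /andP[/adj_fedges vu pth] wE].
  rewrite -(IH u pth wE); case: vu => <-; first by rewrite rt_step.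
  by rewrite rt_step.
have up t x : connect (adj (fedges g)) x (iter t g x).
  elim: t => //= t IH; apply: (connect_trans IH).
  set y := iter t g x; case: (eqVneq (g y) y) => [->//|gy].
  by apply: connect1; apply/imsetP; exists y.
apply: (connect_trans (up #|'I_N| v)); rewrite (sym_connect_sym (@adj_sym N _)).
by rewrite -[iter _ _ _]/(rt g v) e; apply: up.
Qed.

(** A breadth-first tree: with [d] the distance to [r], each other vertex is sent to a neighbour
    strictly closer to [r]. Such a neighbour always exists, so the default in [g] is never taken. *)
Lemma spanning_rooted N (E : graph N) (r : 'I_N) : gconnected E ->
  exists g : {ffun 'I_N -> 'I_N},
    [/\ forestf g, fixedpts g = [set r] & fedges g \subset E].
Proof.
move=> /forallP/(_ r)/forallP cE.
pose walk v t := [exists p : t.-tuple 'I_N, path (adj E) r p && (last r p == v)].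
have exw v : exists t, walk v t.
  have /connectP[p pth ->] := cE v.
  by exists (size p); apply/existsP; exists (in_tuple p); rewrite /= pth eqxx.
pose d v := ex_minn (exw v).
have step v : v != r -> exists2 u, adj E v u & (d u < d v)%N.
  rewrite {2}/d; case: ex_minnP => t /existsP[[p pt] /= /andP[pth /eqP pl]] _ vr.
  case/lastP: p pt pth pl => [|p x] pt pth pl; first by rewrite -pl eqxx in vr.
  move: pth pl; rewrite rcons_path last_rcons => /andP[pth ux] xv.
  exists (last r p); first by rewrite adj_sym -xv.
  move: pt; rewrite size_rcons => /eqP <-; rewrite ltnS /d.
  case: ex_minnP => t' _; apply.
  by apply/existsP; exists (in_tuple p); rewrite /= pth eqxx.
pose g := [ffun v => if v == r then r
  else odflt v [pick u | adj E v u && (d u < d v)%N]].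
have gr : g r = r by rewrite ffunE eqxx.
have gv v : v != r -> adj E v (g v) /\ (d (g v) < d v)%N.
  move=> vr; rewrite ffunE (negPf vr); case: pickP => [u /andP[]//|no].
  by have [u a l] := step v vr; have := no u; rewrite a l.
exists g; split.
- apply: (@forestf_measure _ _ d) => v; case: (eqVneq v r) => [->|vr _].
    by rewrite gr eqxx.
  by have [] := gv v vr.
- apply/setP => v; rewrite !inE; case: (eqVneq v r) => [->|vr]; first by apply/eqP.
  by have [_] := gv v vr; apply: contraTF => /eqP->; rewrite ltnn.
- apply/subsetP => e /imsetP[v]; rewrite inE => gvv ->.
  have vr : v != r by apply: contraNneq gvv => ->; rewrite gr.
  by have [] := gv v vr.
Qed.

Definition rooted N : {set {ffun 'I_N -> 'I_N}} :=
  [set g : {ffun 'I_N -> 'I_N} | forestf g & #|fixedpts g| == 1%N].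

Lemma rooted_rt N (g : {ffun 'I_N -> 'I_N}) v w : g \in rooted N ->
  rt g v = rt g w.
Proof.
rewrite inE => /andP[gf /cards1P[r fr]].
have rtr x : rt g x = r.
  by apply/set1P; rewrite -fr inE rt_fix.
by rewrite !rtr.
Qed.

(** Every edge is a bridge by counting: a connected graph contains the edges of a map with one root,
    hence at least [N - 1] edges, while deleting [e] leaves one fewer. *)
Lemma is_tree_fedges N (g : {ffun 'I_N -> 'I_N}) : g \in rooted N ->
  is_tree (fedges g).
Proof.
move=> gR; move: (gR); rewrite inE => /andP[gf /eqP f1].
apply/and3P; split.
- apply/forallP => e; apply/implyP => /imsetP[i]; rewrite inE => gi ->.
  by rewrite cards2 (eq_sym i) gi.
- apply/forallP => v; apply/forallP => w.
  by rewrite connect_fedges // (rooted_rt v w gR).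
apply/forallP => e; apply/implyP => eE; apply/negP => conn.
have [i _ _] := imsetP eE.
have [h [hf hr hE]] := spanning_rooted i conn.
have := subset_leq_card hE; have := card_fedges hf; have := card_fedges gf.
by rewrite hr cards1 f1 (cardsD1 e (fedges g)) eE; lia.
Qed.

Lemma tree_rooted N (T : graph N) (r : 'I_N) : is_tree T ->
  exists g : {ffun 'I_N -> 'I_N},
    [/\ forestf g, fixedpts g = [set r] & fedges g = T].
Proof.
move=> /and3P[_ cT /forallP bT].
have [g [gf gr gE]] := spanning_rooted r cT; exists g; split=> //.
have gR : g \in rooted N by rewrite inE gf gr cards1.
have /and3P[_ cg _] := is_tree_fedges gR.
apply/eqP; rewrite eqEsubset gE /=; apply/subsetP => e eT; apply/negPn/negP => neg.
have /implyP/(_ eT)/negP := bT e; apply.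
apply/forallP => v; apply/forallP => w; have /forallP/(_ v)/forallP/(_ w) := cg.
apply: connect_sub => x y xy; apply: connect1; rewrite /adj !inE (subsetP gE) // andbT.
by apply: contraNneq neg => <-.
Qed.

(** Induction on the number of steps to the root. The edge from [v] to [g v] belongs to [h]; if it
    pointed from [g v] to [v] there, the induction hypothesis at [g v] would give [g] a cycle of
    length 2. *)
Lemma fedges_root_inj N (g h : {ffun 'I_N -> 'I_N}) r :
  forestf g -> forestf h -> fixedpts g = [set r] -> fixedpts h = [set r] ->
  fedges g = fedges h -> g = h.
Proof.
move=> gf hf gr hr gh.
have fr (f : {ffun 'I_N -> 'I_N}) v : fixedpts f = [set r] -> (f v == v) = (v == r).
  by move/setP/(_ v); rewrite !inE.
apply/ffunP => v; apply/esym.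
have : rt g v = r by apply/eqP; rewrite -(fr g) // rt_fix.
rewrite /rt; elim: #|_| v => [v /= ->|t IH v].
  have /eqP-> : h r == r by rewrite fr.
  by apply/esym/eqP; rewrite fr.
rewrite iterSr => /IH e.
case: (eqVneq (g v) v) => [gv|gv].
  have vr : v == r by rewrite -(fr g) // gv.
  by rewrite gv; apply/eqP; rewrite fr.
have : [set v; g v] \in fedges h by rewrite -gh; apply/imsetP; exists v.
case/(@adj_fedges _ h) => // hgv; case/eqP: gv.
by apply: (@forestf_no_cycle _ g v 1) => //=; rewrite -e.
Qed.

(** A rooting is determined by its root, and each vertex can serve as one. *)
Lemma card_rootings N (T : graph N) : is_tree T ->
  #|[set g in rooted N | fedges g == T]| = N.
Proof.
move=> tT; set S := [set g in _ | _].
have inj : {in S &, injective (fun g : {ffun 'I_N -> 'I_N} => fixedpts g)}.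
  move=> g h; rewrite !inE => /andP[/andP[gf /cards1P[r gr]] /eqP gT].
  move=> /andP[/andP[hf _] /eqP hT] gh.
  by apply: (@fedges_root_inj _ g h r); rewrite -?gh // gT hT.
rewrite -(card_in_imset inj).
suff -> : [set fixedpts g | g : {ffun 'I_N -> 'I_N} in S] = [set [set r] | r : 'I_N].
  by rewrite card_imset ?card_ord //; apply: set1_inj.
apply/setP => A; apply/imsetP/imsetP => [[g]|[r _ ->]].
  by rewrite !inE => /andP[/andP[_ /cards1P[r ->]] _] ->; exists r.
have [g [gf gr gT]] := tree_rooted r tT.
by exists g; rewrite ?gr // !inE gf gr cards1 gT !eqxx.
Qed.

Lemma sum_rooted (V : nmodType) N (F : graph N -> V) :
  \sum_(g in rooted N) F (fedges g) = (\sum_(T | is_tree T) F T) *+ N.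
Proof.
rewrite (partition_big (fun g : {ffun 'I_N -> 'I_N} => fedges g) (@is_tree N)) /=;
  last by move=> g; apply: is_tree_fedges.
rewrite -sumrMnl; apply: eq_bigr => T tT.
rewrite (eq_bigr (fun=> F T)) => [|g /andP[_ /eqP->]//].
rewrite sumr_const; congr (_ *+ _); rewrite -[RHS](card_rootings tT).
by apply: eq_card => g; rewrite [RHS]inE; apply/andP/andP.
Qed.

(** * Weighted tree sums *)

Definition sdeg N (T : graph N) (i : 'I_N) : nat :=
  #|[set j | (j != i) && ([set i; j] \in T)]|.

Lemma prod_edge_weight (R : idomainType) N (T : graph N) (x : R)
    (g : {ffun 'I_N -> 'I_N}) : forestf g ->
  \prod_i (if (i != g i) && ([set i; g i] \in T) then x else 1)
    = x ^+ #|T :&: fedges g|.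
Proof.
move=> gf; rewrite (bigID (fun i => g i != i)) /= [X in _ * X]big1 ?mulr1; last first.
  by move=> i /negPn/eqP gi; rewrite gi eqxx.
transitivity (\prod_(e in fedges g) (if e \in T then x else 1)).
  rewrite big_imset /=; last by move=> i j gi _; apply: fedges_inj.
  by apply: eq_bigr => i gi; rewrite eq_sym gi.
rewrite -big_mkcondr /= -prodr_const; apply: eq_bigl => e.
by rewrite !inE andbC.
Qed.

(* With [J] the all-ones matrix and [L] the Laplacian of [T], this compares
   [det (a - J + y L)] and [det (a + y L)], where [a = n + 2], using
   [(a - J) (a + y L) = a (a - J + y L)]; the roots have weight 1. *)
Lemma weighted_tree_sum_le (R : realFieldType) n (T : graph n.+1) (x : R) : 1 <= x ->
  n.+2%:R * n.+1%:R * (\sum_(T' | is_tree T') x ^+ #|T :&: T'|)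
    <= \prod_(i < n.+1) (n.+2%:R + (x - 1) * (sdeg T i)%:R).
Proof.
move=> x1; set y := x - 1; have y0 : 0 <= y by rewrite subr_ge0.
pose w1 (i j : 'I_n.+1) : R := if (i != j) && ([set i; j] \in T) then x else 1.
pose w2 (i j : 'I_n.+1) : R :=
  if i == j then n.+2%:R else y * ([set i; j] \in T)%:R.
have w2_ge0 i j : 0 <= w2 i j by rewrite /w2; case: ifP; rewrite ?mulr_ge0.
have w2C i j : w2 i j = w2 j i by rewrite /w2 eq_sym setUC.
have sw2 i : \sum_l w2 i l = n.+2%:R + y * (sdeg T i)%:R.
  rewrite (bigD1 i) //= {1}/w2 eqxx; congr (_ + _).
  rewrite /sdeg -sum1_card natr_sum mulr_sumr big_mkcond [RHS]big_mkcond.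
  apply: eq_bigr => j _; rewrite inE /w2 eq_sym.
  by case: eqP => //= _; case: ifP; rewrite ?mulr0.
have w12 i j : w1 i j = w2 i j + 1 - (i == j)%:R * n.+2%:R.
  rewrite /w1 /w2; case: eqP => /= _; first by ring.
  by case: ifP => _; rewrite /y ?mulr1 ?mulr0; ring.
have sw1 i : \sum_l w1 i l = \sum_l w2 i l - 1.
  under eq_bigr do rewrite w12.
  have -> : n.+2%:R = n.+1%:R + 1 :> R by rewrite natr1.
  rewrite sumrB big_split /= sumr_const card_ord -mulr_suml.
  suff -> : \sum_(l < n.+1) (i == l)%:R = 1 :> R by ring.
  rewrite (bigD1 i) //= eqxx big1 ?addr0 // => l /negPf li.
  by rewrite eq_sym li.
pose L w : 'M[R]_n.+1 :=
  \matrix_(i, j) ((i == j)%:R * (\sum_l w i l) - (i != j)%:R * w i j).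
have LE : ((n.+2%:R)%:M - const_mx 1) *m L w2 = n.+2%:R *: L w1.
  rewrite mulmxBl mul_scalar_mx; apply/matrixP => i j; rewrite !mxE.
  have -> : \sum_l (const_mx 1 : 'M[R]_n.+1) i l * L w2 l j = n.+2%:R.
    under eq_bigr do rewrite !mxE mul1r.
    rewrite (bigD1 j) //= eqxx mul1r mul0r subr0.
    rewrite [X in _ + X](eq_bigr (fun l => - w2 j l)) => [|l lj]; last first.
      by rewrite (negPf lj) mul0r sub0r mul1r w2C.
    by rewrite sumrN (bigD1 j) //= addrK /w2 eqxx.
  rewrite sw1 w12; case: (eqVneq i j) => _ /=; ring.
have detE : \det (L w2) = n.+2%:R * \det (L w1).
  have a0 : n.+2%:R != 0 :> R by rewrite pnatr_eq0.
  have := congr1 determinant LE.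
  (* The diagonal weight [n.+2] makes the last factor of the determinant of [a - J] equal to 1. *)
  rewrite det_mulmx detZ det_scalar_sub_const // -natrB // subSnn mulr1 exprS.
  move=> e; apply: (mulfI (expf_neq0 n a0)); rewrite e; ring.
rewrite !det_laplacian in detE.
(* The one-root forests are the rooted trees, [n.+1] for each tree; the remaining forests have
   nonnegative weight. *)
rewrite -mulrA; apply: (@le_trans _ _
  (n.+2%:R * \sum_(g : {ffun 'I_n.+1 -> 'I_n.+1} | forestf g) \prod_i w1 i (g i))).
  rewrite ler_wpM2l // mulr_natl -sum_rooted.
  rewrite [leRHS](bigID (mem (rooted n.+1))) /= -[leLHS]addr0 lerD //.
    rewrite le_eqVlt; apply/orP; left; apply/eqP.
    apply: eq_big => g; first by rewrite inE; case: forestf.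
    by rewrite inE => /andP[gf _]; rewrite -prod_edge_weight.
  apply: sumr_ge0 => g _; apply: prodr_ge0 => i _.
  by rewrite /w1; case: ifP => // _; apply: le_trans x1.
rewrite -detE; under [leRHS]eq_bigr do rewrite -sw2.
(* The expanded product of row sums runs over all self-maps, of which the forests are a part. *)
rewrite bigA_distr_bigA /= [leRHS](bigID (fun g : {ffun _ -> _} => forestf g)) /=.
by rewrite lerDl; apply: sumr_ge0 => g _; apply: prodr_ge0.
Qed.

Lemma sum_sdeg_le N (T : graph N) : is_tree T -> (\sum_i sdeg T i <= 2 * N)%N.
Proof.
case: N T => [T _|n T tT]; first by rewrite big_ord0.
have [g [gf _ <-]] := tree_rooted ord0 tT.
apply: (@leq_trans (\sum_(i < n.+1) \sum_(j < n.+1) ((g i == j) + (g j == i))%N)).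
  apply: leq_sum => i _; rewrite /sdeg -sum1_card big_mkcond; apply: leq_sum => j _.
  rewrite inE; case: (boolP (_ \in _)); rewrite ?andbF // => /adj_fedges.
  by case=> ->; rewrite eqxx; case: ifP => _; rewrite ?addn1.
have one (i : 'I_n.+1) : (\sum_(j < n.+1) (g i == j) = 1)%N.
  rewrite (bigD1 (g i)) //= eqxx big1 // => j /negPf.
  by rewrite eq_sym => ->.
under eq_bigr do rewrite big_split.
rewrite big_split /= [X in (_ + X)%N]exchange_big /=.
rewrite !(eq_bigr _ (fun i _ => one i)).
by rewrite !sum_nat_const card_ord; lia.
Qed.

(** * Stars of rooted trees *)

Lemma fconnectP (T : finType) (f : T -> T) x y :
  reflect (exists m, iter m f x = y) (fconnect f x y).
Proof.
apply: (iffP idP) => [xy|[m <-]]; last exact: fconnect_iter.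
by exists (findex f x y); apply: iter_findex.
Qed.

Lemma fconnect_linear (T : finType) (f : T -> T) x y z :
  fconnect f x y -> fconnect f x z -> fconnect f y z || fconnect f z y.
Proof.
move=> /fconnectP[a <-] /fconnectP[b <-]; apply/orP.
have [le|/ltnW le] := leqP a b; [left|right]; rewrite -(subnK le) iterD;
  exact: fconnect_iter.
Qed.

Lemma rooted_eq_root n (h : {ffun 'I_n.+1 -> 'I_n.+1}) t : h \in rooted n.+1 ->
  (h t == t) = (t == rt h ord0).
Proof.
move=> hR; have hf : forestf h by move: hR; rewrite inE => /andP[].
rewrite -(rooted_rt t ord0 hR); apply/eqP/eqP => [ht|->].
  by rewrite rt_id.
exact: rt_fix.
Qed.

Definition descendants (T : finType) (g : T -> T) (v : T) : {set T} :=
  [set u | fconnect g u v].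

(* Block 0 is a tree rooted at the root of everything; the root of block [j > 0]
   is attached to the vertex [a (j - 1)] of block 0. *)
Definition star_fun K n (H : {ffun 'I_K.+1 -> {ffun 'I_n -> 'I_n}})
    (a : {ffun 'I_K -> 'I_n}) (v : 'I_K.+1 * 'I_n) : 'I_K.+1 * 'I_n :=
  if H v.1 v.2 != v.2 then (v.1, H v.1 v.2)
  else if unlift ord0 v.1 is Some j then (ord0, a j) else v.

(** The starting point [ord0] is arbitrary: in a rooted tree all vertices have the same root. *)
Definition block_root K n (H : {ffun 'I_K.+1 -> {ffun 'I_n.+1 -> 'I_n.+1}}) j :=
  (j, rt (H j) ord0).

Definition block K n (j : 'I_K.+1) : {set 'I_K.+1 * 'I_n} := [set v | v.1 == j].

Lemma card_block K n (j : 'I_K.+1) : #|@block K n j| = n.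
Proof.
have -> : @block K n j = [set (j, t) | t : 'I_n].
  apply/setP => -[i t]; rewrite !inE /=; apply/eqP/imsetP => [->|[u _ [-> _]]//].
  by exists t.
by rewrite card_imset ?card_ord // => x y [].
Qed.

Lemma star_fst K n (H : {ffun 'I_K.+1 -> {ffun 'I_n -> 'I_n}}) a v m :
  (iter m (star_fun H a) v).1 = v.1 \/ (iter m (star_fun H a) v).1 = ord0.
Proof.
elim: m => [|m]; first by left.
rewrite /=; set u := iter m _ v => IH; rewrite /star_fun; case: ifP => // _.
by case: unliftP => //= j _; right.
Qed.

Lemma star_to_block_root K n (H : {ffun 'I_K.+1 -> {ffun 'I_n.+1 -> 'I_n.+1}}) a v :
  (forall j, H j \in rooted n.+1) ->
  fconnect (star_fun H a) v (block_root H v.1).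
Proof.
move=> HR; rewrite /block_root -(rooted_rt v.2 ord0 (HR v.1)) /rt.
elim: #|_| => [|m IH]; first by rewrite /=; case: v.
apply: (connect_trans IH) => /=; set t := iter m _ _.
case: (eqVneq (H v.1 t) t) => [->//|ht].
by apply: connect1; rewrite /= /star_fun /= ht.
Qed.

Lemma star_block_root K n (H : {ffun 'I_K.+1 -> {ffun 'I_n.+1 -> 'I_n.+1}}) a j :
  (forall j, H j \in rooted n.+1) ->
  star_fun H a (block_root H (lift ord0 j)) = (ord0, a j).
Proof.
move=> HR; rewrite /star_fun /= rooted_eq_root // eqxx /=.
by rewrite liftK.
Qed.

Lemma star_fix K n (H : {ffun 'I_K.+1 -> {ffun 'I_n.+1 -> 'I_n.+1}}) a v :
  (forall j, H j \in rooted n.+1) ->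
  (star_fun H a v == v) = (v == block_root H ord0).
Proof.
move=> HR; case: v => j t; rewrite /star_fun /= rooted_eq_root //.
case: (eqVneq t (rt (H j) ord0)) => [->|tr] /=.
  by case: unliftP => [j'|] ->; rewrite ?eqxx // !xpair_eqE.
rewrite !xpair_eqE eqxx /= rooted_eq_root // (negPf tr).
by apply/esym/negbTE; apply: contra tr => /andP[/eqP-> /eqP->].
Qed.

Lemma star_to_root K n (H : {ffun 'I_K.+1 -> {ffun 'I_n.+1 -> 'I_n.+1}}) a v :
  (forall j, H j \in rooted n.+1) ->
  fconnect (star_fun H a) v (block_root H ord0).
Proof.
move=> HR; have := star_to_block_root a v HR.
case: (unliftP ord0 v.1) => [j|] ->// vj; apply: (connect_trans vj).
apply: (@connect_trans _ _ (ord0, a j)).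
  by apply: connect1; rewrite /= star_block_root.
exact: (star_to_block_root a (ord0, a j) HR).
Qed.

Lemma star_rooted K n (H : {ffun 'I_K.+1 -> {ffun 'I_n.+1 -> 'I_n.+1}}) a :
  (forall j, H j \in rooted n.+1) -> forestf (star_fun H a).
Proof.
move=> HR; apply/forestfP => v.
have /fconnectP[m e] := star_to_root a v HR; exists m.
by apply/eqP; rewrite star_fix // e.
Qed.

Lemma descendants_star_sub K n (H : {ffun 'I_K.+1 -> {ffun 'I_n -> 'I_n}}) a j t :
  j != ord0 -> descendants (star_fun H a) (j, t) \subset block n j.
Proof.
move=> j0; apply/subsetP => u; rewrite !inE => /fconnectP[m e].
by have := star_fst H a u m; rewrite e /= => -[->//|/eqP]; rewrite (negPf j0).
Qed.

Lemma descendants_block_root K n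
    (H : {ffun 'I_K.+1 -> {ffun 'I_n.+1 -> 'I_n.+1}}) a j :
  (forall j, H j \in rooted n.+1) -> j != ord0 ->
  descendants (star_fun H a) (block_root H j) = block n.+1 j.
Proof.
move=> HR j0; apply/eqP; rewrite eqEsubset descendants_star_sub //=.
by apply/subsetP => u; rewrite !inE => /eqP <-; apply: star_to_block_root.
Qed.

(** This is what makes the blocks recoverable from the map alone: having exactly as many descendants
    as a block has vertices singles out the roots of the blocks other than block 0. *)
Lemma card_descendants_star K n
    (H : {ffun 'I_K.+1 -> {ffun 'I_n.+1 -> 'I_n.+1}}) a v :
  (0 < K)%N -> (forall j, H j \in rooted n.+1) ->
  (#|descendants (star_fun H a) v| == n.+1)
    = (v.1 != ord0) && (v == block_root H v.1).
Proof.
move=> K0 HR; set G := star_fun H a; case: v => j t /=.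
have fst0 u w : u.1 = ord0 -> fconnect G u w -> w.1 = ord0.
  by move=> u0 /fconnectP[m <-]; case: (star_fst H a u m) => ->.
case: (eqVneq j ord0) => [->|j0] /=.
  apply/negbTE/negP => /eqP cn.
  (* For a vertex of block 0: if its descendants stay in that block they fill it, so the vertex is
     the overall root, which also has descendants elsewhere. Otherwise they contain a whole other
     block together with the vertex itself, one vertex too many. *)
  case: (boolP (descendants G (ord0, t) \subset block n.+1 ord0)) => [sub|].
    have e : descendants G (ord0, t) = block n.+1 ord0.
      by apply/eqP; rewrite eqEcard sub cn card_block leqnn.
    have : block_root H ord0 \in descendants G (ord0, t) by rewrite e inE.
    rewrite inE => /fconnectP[m].
    rewrite (@iter_fix_ge _ G _ 0) //=; last by apply/eqP; rewrite star_fix.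
    move=> tr; have : (lift ord0 (Ordinal K0), t) \in descendants G (ord0, t).
      by rewrite inE -tr star_to_root.
    by rewrite e inE.
  case/subsetPn => u; rewrite !inE => u0 u1.
  have : fconnect G (block_root H u.1) (ord0, t).
    have /orP[//|/fst0 /= e] := fconnect_linear (star_to_block_root a u HR) u0.
    by rewrite e ?eqxx in u1.
  move=> ru; have sub : (ord0, t) |: block n.+1 u.1 \subset descendants G (ord0, t).
    apply/subsetP => w; rewrite !inE => /orP[/eqP->//|/eqP w1].
    by apply: connect_trans ru; rewrite -w1; apply: star_to_block_root.
  have := subset_leq_card sub; rewrite cn cardsU1 card_block inE /= eq_sym u1.
  by rewrite add1n ltnn.
apply/eqP/eqP => [cn|->]; last by rewrite descendants_block_root // card_block.
have e : descendants G (j, t) = block n.+1 j.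
  by apply/eqP; rewrite eqEcard descendants_star_sub // cn card_block leqnn.
(* The orbit of the block root moves at once to block 0 and never returns, so it can meet [(j, t)]
   only at its start. *)
have : block_root H j \in descendants G (j, t) by rewrite e inE.
rewrite inE => /fconnectP[[|m]]; first by move=> /= ->.
case: (unliftP ord0 j) => [j'|] jE; last by rewrite jE eqxx in j0.
have Gj : G (block_root H j) = (ord0, a j') by rewrite /G jE star_block_root.
rewrite iterSr Gj => e'.
have /(fst0 (ord0, a j') (j, t) erefl) /= j00 : fconnect G (ord0, a j') (j, t).
  by apply/fconnectP; exists m.
by rewrite j00 eqxx in j0.
Qed.

(** * Relabelling stars along a bijection *)

Definition conj_fun (A B : finType) (s : A -> B) (G : B -> B) : {ffun A -> A} :=
  [ffun i => odflt i [pick i' | s i' == G (s i)]].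

Lemma conj_funE (A B : finType) (s : A -> B) G i : bijective s ->
  s (conj_fun s G i) = G (s i).
Proof.
case=> s' sK s'K; rewrite ffunE; case: pickP => [i' /eqP//|/(_ (s' (G (s i))))].
by rewrite s'K eqxx.
Qed.

Lemma conj_fun_fix (A B : finType) (s : A -> B) G i : bijective s ->
  (conj_fun s G i == i) = (G (s i) == s i).
Proof. by move=> sb; rewrite -(inj_eq (bij_inj sb)) conj_funE. Qed.

Lemma iter_conj_fun (A B : finType) (s : A -> B) G i m : bijective s ->
  s (iter m (conj_fun s G) i) = iter m G (s i).
Proof. by move=> sb; elim: m => //= m IH; rewrite conj_funE // IH. Qed.

Lemma forestf_conj (A B : finType) (s : A -> B) G : bijective s ->
  forestf G -> forestf (conj_fun s G).
Proof.
move=> sb /forestfP Gf; apply/forestfP => i; have [m e] := Gf (s i); exists m.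
by apply: (bij_inj sb); rewrite conj_funE // iter_conj_fun.
Qed.

Lemma descendants_conj (A B : finType) (s : A -> B) G i : bijective s ->
  descendants (conj_fun s G) i = s @^-1: descendants G (s i).
Proof.
move=> sb; apply/setP => u; rewrite !inE; apply/fconnectP/fconnectP => -[m].
  by move=> <-; exists m; rewrite iter_conj_fun.
by rewrite -iter_conj_fun // => /(bij_inj sb); exists m.
Qed.

Lemma card_preimset_bij (A B : finType) (s : A -> B) (X : {set B}) : bijective s ->
  #|s @^-1: X| = #|X|.
Proof. by move=> sb; apply/on_card_preimset/onW_bij. Qed.

(** The vertices whose edge to the parent cuts off a subtree with [n] vertices, described through
    [g] only, without reference to a block structure. *)
Definition split_verts N n (g : 'I_N -> 'I_N) : {set 'I_N} :=
  [set i | #|descendants g i| == n].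

Lemma split_verts_star N K n (s : 'I_N -> 'I_K.+1 * 'I_n.+1)
    (H : {ffun 'I_K.+1 -> {ffun 'I_n.+1 -> 'I_n.+1}}) a :
  (0 < K)%N -> (forall j, H j \in rooted n.+1) -> bijective s ->
  split_verts n.+1 (conj_fun s (star_fun H a))
    = s @^-1: [set block_root H (lift ord0 j) | j : 'I_K].
Proof.
move=> K0 HR sb; apply/setP => i; rewrite !inE descendants_conj // card_preimset_bij //.
rewrite card_descendants_star //; apply/andP/imsetP => [[j0 /eqP e]|[j _ ->]].
  case: (unliftP ord0 (s i).1) => [j|] je; last by rewrite je eqxx in j0.
  by exists j; rewrite // e je.
by rewrite /= eqxx.
Qed.

Lemma card_split_verts_star N K n (s : 'I_N -> 'I_K.+1 * 'I_n.+1)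
    (H : {ffun 'I_K.+1 -> {ffun 'I_n.+1 -> 'I_n.+1}}) a :
  (0 < K)%N -> (forall j, H j \in rooted n.+1) -> bijective s ->
  #|split_verts n.+1 (conj_fun s (star_fun H a))| = K.
Proof.
move=> K0 HR sb; rewrite split_verts_star // card_preimset_bij // card_imset ?card_ord //.
by move=> i j /(congr1 fst) /lift_inj.
Qed.

Lemma conj_star_rooted N K n (s : 'I_N -> 'I_K.+1 * 'I_n.+1)
    (H : {ffun 'I_K.+1 -> {ffun 'I_n.+1 -> 'I_n.+1}}) a :
  (forall j, H j \in rooted n.+1) -> bijective s ->
  conj_fun s (star_fun H a) \in rooted N.
Proof.
move=> HR sb; rewrite inE forestf_conj ?star_rooted //=.
suff -> : fixedpts (conj_fun s (star_fun H a)) = s @^-1: [set block_root H ord0].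
  by rewrite card_preimset_bij // cards1.
by apply/setP => i; rewrite !inE conj_fun_fix // star_fix.
Qed.

(** Cutting the edge above each of the [K] split vertices turns [g] into the forest [h] of separate
    block trees, whose components are the blocks. *)
Lemma conj_star_splittable N K n (s : 'I_N -> 'I_K.+1 * 'I_n.+1)
    (H : {ffun 'I_K.+1 -> {ffun 'I_n.+1 -> 'I_n.+1}}) a :
  (0 < K)%N -> (forall j, H j \in rooted n.+1) -> bijective s ->
  k_splittable K.+1 (fedges (conj_fun s (star_fun H a))).
Proof.
move=> K0 HR sb; set g := conj_fun s _.
have gR : g \in rooted N by apply: conj_star_rooted.
have gf : forestf g by move: gR; rewrite inE => /andP[].
have Hf j : forestf (H j) by have := HR j; rewrite inE => /andP[].
pose D := split_verts n.+1 g.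
have inD i : (i \in D) = ((s i).1 != ord0) && (s i == block_root H (s i).1).
  by rewrite inE descendants_conj // card_preimset_bij // card_descendants_star.
have Dg i : i \in D -> g i != i.
  rewrite inD conj_fun_fix // star_fix // => /andP[i0 _].
  by apply: contra i0 => /eqP->.
pose h := conj_fun s (fun v => (v.1, H v.1 v.2)).
have itG m (v : 'I_K.+1 * 'I_n.+1) :
    iter m (fun v => (v.1, H v.1 v.2)) v = (v.1, iter m (H v.1) v.2).
  by elim: m => [|m IH]; [case: v|rewrite /= IH].
have hf : forestf h.
  apply: forestf_conj => //; apply/forestfP => v.
  have /forestfP/(_ v.2) [m e] := Hf v.1.
  by exists m; rewrite itG /= e.
have hD i : h i = if i \in D then i else g i.
  apply: (bij_inj sb); rewrite conj_funE // inD.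
  case: (eqVneq (H (s i).1 (s i).2) (s i).2) => [e|ne].
    have sE : s i = block_root H (s i).1.
      rewrite /block_root; move/eqP: e; rewrite rooted_eq_root // => /eqP <-.
      by case: (s i).
    rewrite e -surjective_pairing -sE eqxx andbT; case: (eqVneq (s i).1 ord0) => // i0 /=.
    by rewrite conj_funE // [in LHS]sE [in RHS]sE i0; apply/esym/eqP; rewrite star_fix.
  rewrite [X in if X then _ else _](_ : _ = false); last first.
    apply: contraNF ne => /andP[_ /eqP e]; rewrite rooted_eq_root //.
    by rewrite [X in X.2 == _]e.
  by rewrite conj_funE // /star_fun ne.
pose S := [set [set i; g i] | i in D].
have SE : fedges g :\: S = fedges h.
  apply/setP => e; rewrite inE; apply/andP/imsetP => [[eS /imsetP[i]]|[i]].
    rewrite inE => gi eE; have iD : i \notin D.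
      by apply: contra eS => iD; rewrite eE; apply/imsetP; exists i.
    by exists i; rewrite ?inE hD (negPf iD).
  rewrite inE hD; case: ifP => [_|iD gi ->]; first by rewrite eqxx.
  split; last by apply/imsetP; exists i.
  apply/negP => /imsetP[j jD e']; have ij : i = j by apply: (fedges_inj gf gi e').
  by rewrite ij jD in iD.
pose B j := [set w | (s w).1 == j].
have cardB j : #|B j| = n.+1.
  by rewrite -(card_block n.+1 j) -(card_preimset_bij (@block K n.+1 j) sb);
    apply: eq_card => w; rewrite !inE.
have compE v : component (fedges h) v = B (s v).1.
  have srt u : s (rt h u) = block_root H (s u).1.
    have := rt_fix u hf => /eqP; rewrite conj_fun_fix // /rt iter_conj_fun //.
    rewrite itG /= xpair_eqE eqxx /= rooted_eq_root // => /eqP->.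
    by [].
  apply/setP => w; rewrite !inE connect_fedges // -(inj_eq (bij_inj sb)) !srt.
  by apply/eqP/eqP => [[]//|->].
apply/existsP; exists S; apply/and4P; split.
- apply/subsetP => e /imsetP[i iD ->]; apply/imsetP; exists i => //.
  exact: Dg.
- rewrite card_in_imset ?card_split_verts_star // => i j iD _.
  by apply: fedges_inj; rewrite ?Dg.
- rewrite SE.
  have -> : [set component (fedges h) v | v : 'I_N] = [set B j | j : 'I_K.+1].
    apply/setP => X; apply/imsetP/imsetP => [[v _ ->]|[j _ ->]].
      by exists (s v).1.
    have [s' _ s'K] := sb; exists (s' (j, ord0)) => //.
    by rewrite compE s'K.
  rewrite card_imset ?card_ord // => i j e.
  have : (0 < #|B i|)%N by rewrite cardB.
  case/card_gt0P => w wi; have := wi; rewrite e !inE => /eqP <-.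
  by move: wi; rewrite inE => /eqP.
- by apply/forallP => u; apply/forallP => v; rewrite SE !compE !cardB.
Qed.

(** A step that stays in its block is a step of [H]; a step that leaves it starts at a fixed point
    of [H], and for the block roots it reveals [a]. *)
Lemma star_fun_inj K n (H H' : {ffun 'I_K.+1 -> {ffun 'I_n.+1 -> 'I_n.+1}}) a a' :
  (forall j, H j \in rooted n.+1) -> (forall j, H' j \in rooted n.+1) ->
  star_fun H a =1 star_fun H' a' -> H = H' /\ a = a'.
Proof.
move=> HR HR' e.
have HE (H1 : {ffun 'I_K.+1 -> {ffun 'I_n.+1 -> 'I_n.+1}}) a1 j t :
    H1 j t = if (star_fun H1 a1 (j, t)).1 == j then (star_fun H1 a1 (j, t)).2 else t.
  rewrite /star_fun /=; case: (eqVneq (H1 j t) t) => [Ht|_] /=; last by rewrite eqxx.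
  by rewrite Ht; case: unliftP => [j'|] ->; rewrite ?eqxx.
have HH : H = H'.
  by apply/ffunP => j; apply/ffunP => t; rewrite (HE _ a) (HE _ a') e.
split=> //; apply/ffunP => j; have := e (block_root H (lift ord0 j)).
by rewrite star_block_root // HH star_block_root // => -[].
Qed.

(* The roots of the blocks [j > 0] are exactly the vertices with [n.+1] descendants,
   so [g] and the ranks of these roots determine the blocks; the positions inside the
   blocks are then recorded by [beta]. *)
Lemma card_splittable_rooted K n : (0 < K)%N ->
  ((K.+1 * n.+1)`! * (n.+1 ^ n) ^ K.+1 * n.+1 ^ K
    <= #|[set g in rooted (K.+1 * n.+1) | k_splittable K.+1 (fedges g)]|
       * K.+1 ^ K * (n.+1)`! ^ K.+1)%N.
Proof.
move=> K0; set N := (K.+1 * n.+1)%N.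
have N0 : (0 < N)%N by rewrite muln_gt0.
pose i0 := Ordinal N0.
pose sT := {ffun 'I_N -> 'I_K.+1 * 'I_n.+1}.
pose hT := {ffun 'I_K.+1 -> {ffun 'I_n.+1 -> 'I_n.+1}}.
pose aT := {ffun 'I_K -> 'I_n.+1}.
pose Inj := [set b : {ffun 'I_n.+1 -> 'I_n.+1} | injectiveb b].
pose Dom : {set sT * hT * aT} :=
  setX (setX [set s : sT | injectiveb s] [set H : hT | H \in ffun_on (mem (rooted n.+1))])
    [set: aT].
pose Cod := setX (setX [set g in rooted N | k_splittable K.+1 (fedges g)]
    [set: {ffun 'I_K -> 'I_K.+1}]) [set b : hT | b \in ffun_on (mem Inj)].
have sb (s : sT) : s \in [set s : sT | injectiveb s] -> bijective s.
  rewrite inE => /injectiveP si; apply: inj_card_bij => //.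
  by rewrite card_prod !card_ord.
pose sinv (s : sT) v := odflt i0 [pick i | s i == v].
have sinvK (s : sT) v : bijective s -> s (sinv s v) = v.
  case=> s' _ s'K; rewrite /sinv; case: pickP => [i /eqP//|/(_ (s' v))].
  by rewrite s'K eqxx.
pose B (s : sT) j := [set w | (s w).1 == j].
have cardB (s : sT) j : bijective s -> #|B s j| = n.+1.
  move=> sbij; rewrite -(card_block n.+1 j) -(card_preimset_bij (@block K n.+1 j) sbij).
  by apply: eq_card => w; rewrite !inE.
pose g (s : sT) (H : hT) (a : aT) := conj_fun s (star_fun H a).
pose rho (s : sT) (H : hT) (j : 'I_K) := sinv s (block_root H (lift ord0 j)).
(* The ranks lie below [K]; storing them in the nonempty type ['I_K.+1] allows [inord] and accounts
   for the factor [K.+1 ^ K]. *)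
pose rank (s : sT) (H : hT) (a : aT) : {ffun 'I_K -> 'I_K.+1} :=
  [ffun j => inord (index (rho s H j) (enum (split_verts n.+1 (g s H a))))].
pose beta (s : sT) : hT :=
  [ffun j => [ffun t : 'I_n.+1 => (s (nth i0 (enum (B s j)) t)).2]].
pose Phi (x : sT * hT * aT) :=
  let: (s, H, a) := x in (g s H a, rank s H a, beta s).
have DomP s H a : (s, H, a) \in Dom -> bijective s /\ forall j, H j \in rooted n.+1.
  rewrite in_setX in_setX in_setT andbT /= => /andP[/sb sbij].
  by rewrite inE => /ffun_onP.
have rhoE s H a j : (s, H, a) \in Dom ->
    rho s H j = nth i0 (enum (split_verts n.+1 (g s H a))) (rank s H a j).
  move=> /DomP[sbij HR]; rewrite ffunE inordK; last first.
    by rewrite ltnS (leq_trans (index_size _ _)) // -cardE card_split_verts_star.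
  rewrite nth_index // mem_enum split_verts_star // inE /rho sinvK //.
  by apply/imsetP; exists j.
have fstE s H a i j : (s, H, a) \in Dom ->
    ((s i).1 == lift ord0 j) = (i \in descendants (g s H a) (rho s H j)).
  move=> /DomP[sbij HR]; rewrite descendants_conj // inE sinvK //.
  by rewrite descendants_block_root // inE.
have sndE (s : sT) i : bijective s ->
    exists2 t : 'I_n.+1, (s i).2 = beta s (s i).1 t &
      t = index i (enum (B s (s i).1)) :> nat.
  move=> sbij.
  have iB : i \in enum (B s (s i).1) by rewrite mem_enum inE.
  have lt : (index i (enum (B s (s i).1)) < n.+1)%N.
    by move: iB; rewrite -index_mem -cardE cardB.
  by exists (Ordinal lt) => //; rewrite !ffunE /= nth_index.
(* Order of recovery: [g] and the ranks give the block roots, hence the blocks as sets of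
   descendants, block 0 being what remains; [beta] then gives [s], and undoing the conjugation gives
   [H] and [a]. *)
have PhiI : {in Dom &, injective Phi}.
  move=> [[s H] a] [[s' H'] a'] D D' /= [eg er eb].
  have [sbij HR] := DomP _ _ _ D; have [sbij' HR'] := DomP _ _ _ D'.
  have e1 i : (s i).1 = (s' i).1.
    have ej j : ((s i).1 == lift ord0 j) = ((s' i).1 == lift ord0 j).
      by rewrite (fstE _ _ _ _ _ D) (fstE _ _ _ _ _ D') (rhoE _ _ _ _ D)
        (rhoE _ _ _ _ D') er eg.
    case: (unliftP ord0 (s i).1) => [j|] jE.
      by apply/esym/eqP; rewrite jE -ej jE.
    case: (unliftP ord0 (s' i).1) => [j|] jE'; last by rewrite jE.
    by have := ej j; rewrite jE jE' eqxx.
  have eB j : B s j = B s' j by apply/setP => i; rewrite !inE e1.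
  have es : s = s'.
    apply/ffunP => i; have [t e2 tE] := sndE s i sbij; have [t' e2' tE'] := sndE s' i sbij'.
    have tt : t = t' by apply: val_inj; rewrite /= tE tE' e1 eB.
    by rewrite [LHS]surjective_pairing [RHS]surjective_pairing e2 e2' tt e1 eb.
  have [|-> ->//] := @star_fun_inj _ _ H H' a a' HR HR'; last by rewrite es.
  move=> v; have [s1 _ s1K] := sbij; rewrite -(s1K v).
  rewrite -(conj_funE (star_fun H a)) // -/(g s H a) eg /g es conj_funE //.
have sub : [set Phi x | x in Dom] \subset Cod.
  apply/subsetP => y /imsetP[[[s H] a] D ->].
  have [sbij HR] := DomP _ _ _ D.
  rewrite in_setX in_setX in_setT andbT /=; apply/andP; split.
    by rewrite inE conj_star_rooted // conj_star_splittable.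
  rewrite inE; apply/ffun_onP => j; rewrite inE; apply/injectiveP.
  move=> t t'; rewrite !ffunE => e2.
  have memB (u : 'I_n.+1) : nth i0 (enum (B s j)) u \in B s j.
    by rewrite -mem_enum mem_nth // -cardE cardB.
  have : nth i0 (enum (B s j)) t = nth i0 (enum (B s j)) t'.
    apply: (bij_inj sbij); rewrite [LHS]surjective_pairing [RHS]surjective_pairing e2.
    by have := memB t; have := memB t'; rewrite !inE => /eqP-> /eqP->.
  by move/eqP; rewrite nth_uniq -?cardE ?cardB ?enum_uniq // => /eqP/val_inj.
have := subset_leq_card sub; rewrite card_in_imset // !cardsX !cardsT.
rewrite card_inj_ffuns !cardsE !card_ffun_on !card_ffun card_prod !card_ord ffactnn.
by rewrite /Inj cardsE -cardsE card_inj_ffuns card_ord ffactnn card_rooted_trees.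
Qed.

(** * Trees in random graphs *)

Definition pairs N : {set {set 'I_N}} := [set e : {set 'I_N} | #|e| == 2].

Lemma simple_graphE N (E : graph N) : simple_graph E = (E \subset pairs N).
Proof.
by apply/forallP/subsetP => [h e eE|h e]; [rewrite inE; have /implyP := h e; apply|
  apply/implyP => /h; rewrite inE].
Qed.

Lemma card_pairs N : #|pairs N| = 'C(N, 2).
Proof. by rewrite card_draws card_ord. Qed.

Definition supergraphs N m (F : graph N) : {set graph N} :=
  [set E : graph N | [&& simple_graph E, #|E| == m & F \subset E]].

Lemma card_supergraphs N m (F : graph N) : simple_graph F -> (#|F| <= m)%N ->
  #|supergraphs m F| = 'C('C(N, 2) - #|F|, m - #|F|).
Proof.
rewrite simple_graphE => FK Fm.
have inj : {in supergraphs m F &, injective (fun E : graph N => E :\: F)}.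
  move=> E E'; rewrite !inE => /and3P[_ _ FE] /and3P[_ _ FE'] e.
  by rewrite -(setID E F) -(setID E' F) e (setIidPr FE) (setIidPr FE').
rewrite -(card_in_imset inj) -card_pairs -(cardsDS FK) -cards_draws.
apply: eq_card => A; rewrite inE; apply/imsetP/andP => [[E]|[AK /eqP cA]].
  rewrite inE simple_graphE => /and3P[EK /eqP cE FE] ->.
  by rewrite setSD // cardsDS // cE.
have AF : A :&: F = set0.
  by apply/eqP; rewrite setI_eq0; move: AK; rewrite subsetD => /andP[].
exists (A :|: F); last by rewrite setDUl setDv setU0; apply/esym/setDidPl; rewrite -setI_eq0 AF.
rewrite inE simple_graphE subUset FK (subset_trans AK (subsetDl _ _)) subsetUr /=.
by rewrite cardsU AF cards0 cA subn0 subnK // eqxx.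
Qed.

Lemma connected_supergraph N m (T E : graph N) : is_tree T ->
  E \in supergraphs m T -> E \in connected_graphs N m.
Proof.
move=> /and3P[_ cT _]; rewrite !inE => /and3P[-> -> TE] /=.
apply/forallP => v; apply/forallP => w; have /forallP/(_ v)/forallP/(_ w) := cT.
by apply: connect_sub => x y xy; apply: connect1; apply: (subsetP TE).
Qed.

Lemma card_tree N (T : graph N) : (0 < N)%N -> is_tree T -> #|T| = N.-1.
Proof.
move=> N0 tT; have [g [gf gr <-]] := tree_rooted (Ordinal N0) tT.
by have := card_fedges gf; rewrite gr cards1; lia.
Qed.

Definition splittable_trees N k : {set graph N} :=
  [set T | is_tree T & k_splittable k T].

(* The probability that a uniform [m]-subset of an [M]-set contains [j] given points. *)
Definition incl_prob (R : realFieldType) (M m j : nat) : R :=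
  \prod_(t < j) ((m%:R - t%:R) / (M%:R - t%:R)).

Lemma incl_probS (R : realFieldType) M m j :
  incl_prob R M m j.+1 = incl_prob R M m j * ((m%:R - j%:R) / (M%:R - j%:R)).
Proof. by rewrite /incl_prob big_ord_recr. Qed.

Lemma incl_prob_gt0 (R : realFieldType) M m j : (j <= m)%N -> (m <= M)%N ->
  0 < incl_prob R M m j.
Proof.
move=> jm mM; apply: prodr_gt0 => t _; have tj := ltn_ord t.
by rewrite divr_gt0 // subr_gt0 ltr_nat; lia.
Qed.

Lemma bin_incl_prob (R : realFieldType) M m j : (j <= m)%N -> (m <= M)%N ->
  'C(M - j, m - j)%:R = 'C(M, m)%:R * incl_prob R M m j.
Proof.
move=> + mM; elim: j => [_|j IH jm]; first by rewrite /incl_prob big_ord0 !subn0 mulr1.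
rewrite incl_probS mulrA -IH ?(ltnW jm) //.
have Mj : (M%:R - j%:R : R) != 0 by rewrite -natrB ?pnatr_eq0; lia.
apply: (mulIf Mj); rewrite -mulrA divfK // -!natrB ?(leq_trans (ltnW jm)) ?(ltnW jm) //.
rewrite -!natrM; congr (_%:R).
have := mul_bin_diag (M - j) (m - j.+1); rewrite -subnS.
have -> : (m - j.+1).+1 = (m - j)%N by lia.
by rewrite mulnC => ->; rewrite mulnC.
Qed.

(** Negative dependence: [(m - t) / (M - t)] decreases in [t], so shifting the last [c] factors by
    [a] lowers them. *)
Lemma incl_probD (R : realFieldType) M m a c : (a + c <= m)%N -> (m <= M)%N ->
  incl_prob R M m (a + c) <= incl_prob R M m a * incl_prob R M m c.
Proof.
move=> + mM; elim: c => [_|c IH acm]; first by rewrite addn0 /incl_prob big_ord0 mulr1.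
rewrite addnS in acm *.
rewrite !incl_probS mulrA ler_pM //.
- by apply/ltW/incl_prob_gt0 => //; apply: ltnW.
- by rewrite divr_ge0 // subr_ge0 ler_nat; lia.
- by apply: IH; apply: ltnW.
rewrite ler_pdivrMr ?subr_gt0 ?ltr_nat; last by lia.
rewrite mulrAC ler_pdivlMr ?subr_gt0 ?ltr_nat; last by lia.
have a0 : 0 <= a%:R :> R by [].
have mM' : m%:R <= M%:R :> R by rewrite ler_nat.
rewrite natrD -subr_ge0.
have -> : (m%:R - c%:R) * (M%:R - (a%:R + c%:R))
  - (m%:R - (a%:R + c%:R)) * (M%:R - c%:R) = a%:R * (M%:R - m%:R) :> R by ring.
by rewrite mulr_ge0 // subr_ge0.
Qed.

(** Each of the [i] additional factors has index below [N], hence is at least [(m - N) / M]. *)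
Lemma incl_prob_ratio (R : realFieldType) M m N c i :
  (c + i <= N)%N -> (N < m)%N -> (m <= M)%N ->
  incl_prob R M m c <= incl_prob R M m (c + i) * (M%:R / (m%:R - N%:R)) ^+ i.
Proof.
move=> + Nm mM; elim: i => [_|i IH ciN]; first by rewrite addn0 expr0 mulr1.
rewrite addnS in ciN *.
apply: (le_trans (IH (ltnW ciN))); rewrite incl_probS exprS.
set x := M%:R / _.
have mN : 0 < m%:R - N%:R :> R by rewrite subr_gt0 ltr_nat.
have P0 : 0 <= incl_prob R M m (c + i) by apply/ltW/incl_prob_gt0; lia.
have x0 : 0 <= x by rewrite divr_ge0 // ltW.
set t := (c + i)%N; set q := (m%:R - t%:R) / _.
have -> : incl_prob R M m t * q * (x * x ^+ i) = incl_prob R M m t * x ^+ i * (q * x).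
  by ring.
rewrite ler_peMr ?mulr_ge0 ?exprn_ge0 //.
have tM : 0 < M%:R - t%:R :> R by rewrite subr_gt0 ltr_nat /t; lia.
rewrite /q /x mulrACA -invfM ler_pdivlMr ?mulr_gt0 // mul1r.
have tN : t%:R <= N%:R :> R by rewrite ler_nat /t; lia.
have Mt : 0 <= t%:R :> R by [].
rewrite [leRHS]mulrC; apply: ler_pM; rewrite ?(ltW mN) ?(ltW tM) //; lra.
Qed.

(** The union has [2 (N - 1)] edges less the common ones. Submultiplicativity separates the two
    trees, and [incl_prob_ratio] restores the missing factors at a cost of one ratio per common
    edge. *)
Lemma card_supergraphs_pair (R : realFieldType) N m (T T' : graph N) :
  (0 < N)%N -> (2 * N <= m)%N -> (m <= 'C(N, 2))%N -> is_tree T -> is_tree T' ->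
  #|supergraphs m (T :|: T')|%:R
    <= 'C('C(N, 2), m)%:R * incl_prob R 'C(N, 2) m N.-1 ^+ 2
       * ('C(N, 2)%:R / (m%:R - N%:R)) ^+ #|T :&: T'|.
Proof.
move=> N0 Nm mM tT tT'.
have sT : simple_graph T by case/and3P: tT.
have sT' : simple_graph T' by case/and3P: tT'.
have cT := card_tree N0 tT; have cT' := card_tree N0 tT'.
have cI : (#|T :&: T'| <= N.-1)%N by rewrite -cT subset_leq_card ?subsetIl.
have cU : #|T :|: T'| = (N.-1 + (N.-1 - #|T :&: T'|))%N by rewrite cardsU cT cT'; lia.
rewrite card_supergraphs; last first.
- by rewrite cU; lia.
- by rewrite simple_graphE subUset -!simple_graphE sT.
rewrite bin_incl_prob // ?cU; last by lia.
rewrite -mulrA ler_wpM2l //.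
apply: le_trans (incl_probD _ _ _) _ => //; first by lia.
rewrite expr2 -mulrA ler_wpM2l //; first by apply/ltW/incl_prob_gt0; lia.
have := @incl_prob_ratio R 'C(N, 2) m N (N.-1 - #|T :&: T'|) #|T :&: T'|.
by rewrite subnK //; apply; lia.
Qed.

(** * Double counting of trees and pairs of trees *)

Lemma tau_kE N k (E : graph N) :
  tau_k k E = (\sum_(T in splittable_trees N k) (T \subset E))%N.
Proof.
rewrite /tau_k -sum1_card big_mkcond [RHS]big_mkcond; apply: eq_bigr => T _.
by rewrite !inE; case: (T \subset E); case: is_tree; case: k_splittable.
Qed.

Lemma tauE N (E : graph N) : tau E = (\sum_(T | is_tree T) (T \subset E))%N.
Proof.
rewrite /tau -sum1_card big_mkcond [RHS]big_mkcond; apply: eq_bigr => T _.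
by rewrite !inE; case: (T \subset E); case: is_tree.
Qed.

Lemma sum_tau_k N k m :
  (\sum_(E in connected_graphs N m) tau_k k E
    = \sum_(T in splittable_trees N k) #|supergraphs m T|)%N.
Proof.
under eq_bigr do rewrite tau_kE.
rewrite exchange_big /=; apply: eq_bigr => T; rewrite inE => /andP[tT _].
rewrite -sum1_card big_mkcond [RHS]big_mkcond; apply: eq_bigr => E _.
case: (boolP (E \in supergraphs m T)) => [ES|].
  by rewrite (connected_supergraph tT ES); move: ES; rewrite inE => /and3P[_ _ ->].
by rewrite !inE; case: simple_graph => //=; case: (#|E| == m) => //=; case: gconnected => //=;
  case: subset.
Qed.

Lemma sum_tau_k_tau N k m :
  (\sum_(E in connected_graphs N m) tau_k k E * tau E
    <= \sum_(T in splittable_trees N k) \sum_(T' | is_tree T')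
         #|supergraphs m (T :|: T')|)%N.
Proof.
under eq_bigr do rewrite tau_kE tauE big_distrlr /=.
rewrite exchange_big /=; apply: leq_sum => T _.
rewrite exchange_big /=; apply: leq_sum => T' _.
rewrite -sum1_card [X in (X <= _)%N]big_mkcond [X in (_ <= X)%N]big_mkcond; apply: leq_sum => E _.
rewrite !inE subUset; case: simple_graph => //=; case: (#|E| == m) => //=.
by case: gconnected => //=; case: (T \subset E); case: (T' \subset E).
Qed.

(* [1 / t >= 2 l - l^2 t] replaces the Cauchy-Schwarz inequality. *)
Lemma mean_split_ratio_ge (R : realFieldType) N k m (W : R) :
  (0 < N)%N -> (2 * N <= m)%N -> (m <= 'C(N, 2))%N -> 0 < W ->
  (forall T : graph N, is_tree T ->
     \sum_(T' | is_tree T') ('C(N, 2)%:R / (m%:R - N%:R)) ^+ #|T :&: T'| <= W) ->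
  #|splittable_trees N k|%:R / W
    <= #|connected_graphs N m|%:R^-1
       * \sum_(E in connected_graphs N m) ((tau_k k E)%:R / (tau E)%:R).
Proof.
move=> N0 Nm mM W0 HW.
set C := connected_graphs N m; set M := 'C(N, 2) in HW mM *.
set P := incl_prob R M m N.-1; pose b := 'C(M, m)%:R : R.
have P0 : 0 < P by apply: incl_prob_gt0; lia.
have b0 : 0 < b by rewrite ltr0n bin_gt0.
(* The maximiser of [2 l X - l^2 X P W], the lower bound that results from summing the tangent
   inequality. *)
pose l := (P * W)^-1; have l0 : 0 < l by rewrite invr_gt0 mulr_gt0.
set A := splittable_trees N k.
pose X : R := \sum_(E in C) (tau_k k E)%:R.
have XE : X = #|A|%:R * (b * P).
  rewrite /X -natr_sum sum_tau_k natr_sum (eq_bigr (fun=> b * P)).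
    by rewrite sumr_const mulr_natl.
  move=> T; rewrite inE => /andP[tT _]; have cT := card_tree N0 tT.
  have sT : simple_graph T by case/and3P: tT.
  by rewrite card_supergraphs // ?bin_incl_prob ?cT //; lia.
have YE : \sum_(E in C) (tau_k k E)%:R * (tau E)%:R <= X / l.
  under eq_bigr do rewrite -natrM.
  rewrite -natr_sum; apply: le_trans (_ : _ <= _%:R) _.
    by rewrite ler_nat; apply: sum_tau_k_tau.
  rewrite natr_sum XE /l invrK -mulrA mulr_natl -sumr_const; apply: ler_sum => T.
  rewrite inE => /andP[tT _]; rewrite natr_sum.
  apply: le_trans (_ : _ <= b * P ^+ 2 * W) _; last by rewrite expr2 !mulrA.
  apply: le_trans (_ : _ <= \sum_(T' | is_tree T')
      b * P ^+ 2 * (M%:R / (m%:R - N%:R)) ^+ #|T :&: T'|) _.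
    by apply: ler_sum => T' tT'; apply: card_supergraphs_pair.
  rewrite -mulr_sumr ler_wpM2l ?HW // mulr_ge0 ?exprn_ge0 // ltW //.
have term E : l * (tau_k k E)%:R *+ 2 - l ^+ 2 * ((tau_k k E)%:R * (tau E)%:R)
    <= (tau_k k E)%:R / (tau E)%:R :> R.
  (* Without spanning trees both sides vanish, division by 0 being 0. *)
  have [t0|t0] := posnP (tau E).
    have -> : tau_k k E = 0%N.
      apply/eqP; rewrite -leqn0 -t0 subset_leq_card //.
      by apply/subsetP => T; rewrite inE => /andP[].
    by rewrite mulr0n !mul0r !mulr0 mul0rn subr0.
  have tR : 0 < (tau E)%:R :> R by rewrite ltr0n.
  rewrite ler_pdivlMr // -subr_ge0.
  set a := (tau_k k E)%:R; set t := (tau E)%:R.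
  have -> : a - (l * a *+ 2 - l ^+ 2 * (a * t)) * t = a * (1 - l * t) ^+ 2 by ring.
  by rewrite mulr_ge0 // sqr_ge0.
have Sge : X * l <= \sum_(E in C) ((tau_k k E)%:R / (tau E)%:R).
  apply: (@le_trans _ _ (\sum_(E in C)
      (l * (tau_k k E)%:R *+ 2 - l ^+ 2 * ((tau_k k E)%:R * (tau E)%:R)))); last first.
    by apply: ler_sum => E _; exact: term.
  rewrite sumrB sumrMnl -!mulr_sumr -/X.
  apply: le_trans (_ : _ <= l * X *+ 2 - l ^+ 2 * (X / l)) _; last first.
    by rewrite lerD2l lerN2 ler_wpM2l // exprn_ge0 // ltW.
  have -> : l ^+ 2 * (X / l) = l * X.
    by field; rewrite gt_eqF.
  by rewrite mulr2n addrK mulrC.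
(* With no connected graph the right-hand side is 0 by convention, and [X = 0] forces the set of
   splittable trees to be empty. *)
have [C0|C0] := posnP #|C|.
  have X0 : X = 0.
    by rewrite /X big1 // => E EC; move/eqP: C0; rewrite cards_eq0 => /eqP C0; rewrite C0 inE in EC.
  move: X0; rewrite XE => /eqP; rewrite mulf_eq0 (gt_eqF (mulr_gt0 b0 P0)) orbF => /eqP ->.
  by rewrite mul0r C0 invr0 mul0r.
have Cb : #|C|%:R <= b.
  rewrite ler_nat -[X in 'C(X, _)]card_pairs -cards_draws subset_leq_card //.
  by apply/subsetP => E; rewrite !inE simple_graphE => /and3P[-> ->].
have CR : 0 < #|C|%:R :> R by rewrite ltr0n.
rewrite [leRHS]mulrC ler_pdivlMr //; apply: le_trans Sge.
have -> : X * l = #|A|%:R / W * b.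
  rewrite XE /l; field; rewrite ?gt_eqF //.
by rewrite ler_wpM2l // divr_ge0 // ltW.
Qed.

(** * Number of splittable trees *)

Lemma fact_addn m k : ((m + k)`! = m`! * \prod_(i < k) (m + i.+1))%N.
Proof.
elim: k => [|k IH]; first by rewrite addn0 big_ord0 muln1.
by rewrite addnS factS IH big_ord_recr /= addnS mulnC mulnA.
Qed.

(* Pairing the factors [K.+1 * n + i] and [K.+1 * n + (K.+1 - i)]. *)
Lemma prod_block_sq_ge K n :
  ((K.+1 ^ 2 * (n * n.+1)) ^ K <= (\prod_(i < K) (K.+1 * n + i.+1)) ^ 2)%N.
Proof.
have e : (\prod_(i < K) (K.+1 * n + i.+1) = \prod_(i < K) (K.+1 * n + (K - i.+1).+1))%N.
  by rewrite (reindex_inj rev_ord_inj).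
rewrite -[X in (_ <= X)%N]mulnn {2}e -big_split /=.
rewrite -[X in (_ ^ X <= _)%N](card_ord K) -prod_nat_const; apply: leq_prod => i _.
have Ke : K.+1 = (i.+1 + (K - i.+1).+1)%N by have := ltn_ord i; lia.
move: (K - i.+1)%N Ke => j Ke.
rewrite [X in (_ <= X)%N](_ : _ = (K.+1 ^ 2 * (n * n.+1) + i.+1 * j.+1)%N) ?leq_addr //.
by rewrite Ke; ring.
Qed.

(* [((k n)! / (n!^k k^(k n)))^2 n^(k-1)] is nondecreasing in [n]. *)
Lemma multinomial_sq_ge K n :
  ((K.+1`! * (n.+1`! ^ K.+1 * K.+1 ^ (K.+1 * n.+1))) ^ 2
    <= (K.+1 ^ K.+1 * (K.+1 * n.+1)`!) ^ 2 * n.+1 ^ K)%N.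
Proof.
set k := K.+1; elim: n => [|n IH].
  by rewrite (_ : 1`! = 1)%N // !exp1n mul1n !muln1 mulnC.
have k0 : (0 < k)%N by [].
pose Q := (\prod_(i < K) (k * n.+1 + i.+1))%N.
have fE : ((k * n.+2)`! = (k * n.+1)`! * (Q * (k * n.+2)))%N.
  have -> : (k * n.+2 = k * n.+1 + k)%N by rewrite [LHS]mulnS addnC.
  by rewrite fact_addn /k big_ord_recr.
have QE := prod_block_sq_ge K n.+1; rewrite -/k -/Q in QE.
have HE : (k ^ (k * n.+2) = k ^ k * k ^ (k * n.+1))%N by rewrite mulnS expnD.
rewrite fE HE factS (expnMn n.+2).
set F := (n.+1)`! in IH *; set G := (k * n.+1)`! in IH *.
set H := (k ^ (k * n.+1))%N in IH *.
have -> : ((k`! * (n.+2 ^ k * F ^ k * (k ^ k * H))) ^ 2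
  = (k`! * (F ^ k * H)) ^ 2 * ((n.+2 * k) ^ k) ^ 2)%N.
  by rewrite -[RHS]expnMn (expnMn n.+2 k k); congr (_ ^ 2)%N; lia.
have -> : ((k ^ k * (G * (Q * (k * n.+2)))) ^ 2 * n.+2 ^ K
  = (k ^ k * G) ^ 2 * (Q ^ 2 * (k * n.+2) ^ 2 * n.+2 ^ K))%N.
  by move: (k ^ k)%N (k * n.+2)%N (n.+2 ^ K)%N => x y z; ring.
have nK : (0 < n.+1 ^ K)%N by rewrite expn_gt0.
rewrite -(leq_pmul2r nK).
apply: (@leq_trans ((k ^ k * G) ^ 2 * n.+1 ^ K * ((n.+2 * k) ^ k) ^ 2 * n.+1 ^ K)%N).
  by rewrite !leq_mul2r IH !orbT.
have e : (((n.+2 * k) ^ k) ^ 2 * n.+1 ^ K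
  = (k ^ 2 * (n.+1 * n.+2)) ^ K * ((k * n.+2) ^ 2 * n.+2 ^ K))%N.
  have -> : ((n.+2 * k) ^ k = n.+2 * k * (n.+2 ^ K * k ^ K))%N.
    by rewrite -expnMn -expnS.
  rewrite (expnMn (k ^ 2)) (expnMn n.+1) -expnM (mulnC 2%N) expnM.
  by move: (k ^ K)%N (n.+2 ^ K)%N (n.+1 ^ K)%N => x y z; ring.
rewrite -[X in (X <= _)%N]mulnA e.
rewrite [X in (X <= _)%N](_ : _ =
  (k ^ k * G) ^ 2 * ((k ^ 2 * (n.+1 * n.+2)) ^ K * (k * n.+2) ^ 2 * n.+2 ^ K) * n.+1 ^ K)%N.
  by rewrite leq_mul2r leq_mul2l leq_mul2r leq_mul2r QE !orbT.
ring.
Qed.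

Lemma card_splittable_rootedE N k :
  #|[set g in rooted N | k_splittable k (fedges g)]| = (N * #|splittable_trees N k|)%N.
Proof.
have := sum_rooted (fun T : graph N => nat_of_bool (k_splittable k T)).
rewrite -[RHS]mulr_natr natn [in RHS]mulrC => e; rewrite -sum1_card.
transitivity (\sum_(g in rooted N) nat_of_bool (k_splittable k (fedges g)))%R.
  rewrite [RHS]big_mkcond [LHS]big_mkcond; apply: eq_bigr => g _.
  by rewrite inE; case: (g \in rooted N) => //=; case: k_splittable.
rewrite e; congr (_ * _)%N; rewrite -sum1_card [LHS]big_mkcond [RHS]big_mkcond.
by apply: eq_bigr => T _; rewrite inE; case: is_tree => //=; case: k_splittable.
Qed.

Lemma card_splittable_trees_ge K n : (0 < K)%N ->
  ((K.+1 * n.+1)`! * n.+1 ^ (K.+1 * n.+1).-1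
    <= K.+1 * n.+1 * #|splittable_trees (K.+1 * n.+1) K.+1|
       * K.+1 ^ K * (n.+1)`! ^ K.+1)%N.
Proof.
move=> K0; rewrite -card_splittable_rootedE.
apply: leq_trans (card_splittable_rooted n K0).
(* The exponents agree: [n * K.+1 + K] is [(K.+1 * n.+1).-1]. *)
rewrite -mulnA -expnM -expnD leq_mul2l leq_pexp2l ?orbT //; nia.
Qed.

(** * Asymptotics *)

From mathcomp Require Import all_classical all_reals all_analysis.
Import Order.TTheory GRing.Theory Num.Theory.
Local Open Scope ring_scope.

(** By [1 + u <= e^u] and the bound [2 N] on the sum of degrees, the product of row weights is at
    most [(N + 1)^N e^(2 (x - 1))]. Passing from [(N + 1)^(N - 1)] to [N^(N - 1)] costs a factor
    [e], absorbed by the difference between [x - 1] and [x]. *)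
Lemma tree_overlap_sum_le (R : realType) N (T : graph N) (x : R) :
  (2 <= N)%N -> is_tree T -> 1 <= x ->
  \sum_(T' | is_tree T') x ^+ #|(T :&: T')%SET| <= N%:R ^+ (N - 2) * expR (2 * x).
Proof.
case: N T => [//|n] T n1 tT x1.
have := weighted_tree_sum_le T x1; set S := \sum_(T' | _) _; set y := x - 1.
have y0 : 0 <= y by rewrite subr_ge0.
have N1 : 0 < n.+1%:R :> R by rewrite ltr0n.
have N2 : 0 < n.+2%:R :> R by rewrite ltr0n.
set P := \prod_(i < _) _ => SP.
have PE : P <= n.+2%:R ^+ n.+1 * expR (2 * y).
  apply: (@le_trans _ _ (\prod_(i < n.+1) (n.+2%:R * expR (y * (sdeg T i)%:R / n.+2%:R)))).
    apply: ler_prod => i _; apply/andP; split.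
      by rewrite addr_ge0 // mulr_ge0.
    apply: le_trans (_ : _ <= n.+2%:R * (1 + y * (sdeg T i)%:R / n.+2%:R)) _.
      by rewrite mulrDr mulr1 mulrC mulrCA divff ?mulr1 1?mulrC ?gt_eqF.
    by rewrite ler_wpM2l // expR_ge1Dx.
  rewrite big_split /= prodr_const card_ord ler_wpM2l ?exprn_ge0 //.
  rewrite -expR_sum ler_expR -mulr_suml -mulr_sumr ler_pdivrMr //.
  rewrite [2 * y]mulrC -mulrA ler_wpM2l // -natr_sum -natrM ler_nat.
  by apply: leq_trans (sum_sdeg_le tT) _; rewrite leq_mul2l leqnSn orbT.
have NE : n.+2%:R ^+ n <= n.+1%:R ^+ n * expR 1 :> R.
  apply: (@le_trans _ _ ((n.+1%:R * expR (n.+1%:R^-1)) ^+ n)).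
    rewrite lerXn2r ?nnegrE ?mulr_ge0 ?expR_ge0 //.
    apply: le_trans (_ : _ <= n.+1%:R * (1 + n.+1%:R^-1)) _.
      by rewrite mulrDr mulr1 divff ?gt_eqF // natr1.
    by rewrite ler_wpM2l // expR_ge1Dx.
  rewrite exprMn ler_wpM2l ?exprn_ge0 // -expRM_natl ler_expR.
  by rewrite ler_pdivrMr // mul1r ler_nat.
have S1 : n.+1%:R * S <= n.+2%:R ^+ n * expR (2 * y).
  rewrite -(ler_pM2l N2) mulrA; apply: (le_trans SP); apply: (le_trans PE).
  by rewrite exprS mulrA.
rewrite -(ler_pM2l N1); apply: (le_trans S1).
apply: (@le_trans _ _ (n.+1%:R ^+ n * expR 1 * expR (2 * y))).
  by rewrite ler_wpM2r ?expR_ge0.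
have -> : n.+1%:R * (n.+1%:R ^+ (n.+1 - 2) * expR (2 * x)) = n.+1%:R ^+ n * expR (2 * x).
  by rewrite mulrA -exprS; congr (_ ^+ _ * _); lia.
rewrite -mulrA ler_wpM2l ?exprn_ge0 // -expRD ler_expR /y; lra.
Qed.

Lemma card_splittable_trees_ge_powR (R : realType) K n : (0 < K)%N -> (0 < n)%N ->
  K.+1`!%:R / (K.+1 ^ K.+1 * K.+1 ^ K)%:R * n%:R `^ ((1 - K.+1%:R) / 2)
    * (K.+1 * n)%:R ^+ (K.+1 * n - 2)
    <= #|splittable_trees (K.+1 * n) K.+1|%:R :> R.
Proof.
case: n => // n K0 _; set k := K.+1; set N := (k * n.+1)%N.
set A := #|_|; set z : R := _ `^ _.
have n0 : 0 < n.+1%:R :> R by rewrite ltr0n.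
have z0 : 0 < z by rewrite powR_gt0.
(* [z] is the half-integer power of the bound; squaring it reduces the multinomial estimate to the
   one over the natural numbers. *)
have z2 : z ^+ 2 * n.+1%:R ^+ K = 1.
  rewrite -powR_mulrn ?(ltW z0) // /z -powRrM -powR_mulrn ?ler0n // -powRD; last first.
    by apply/implyP => _; rewrite gt_eqF.
  rewrite (_ : _ + _ = 0) ?powRr0 // /k -[in X in 1 - X]natr1; lra.
have F0 : 0 < (n.+1`! ^ k)%:R :> R by rewrite ltr0n expn_gt0 fact_gt0.
have mult : k`!%:R * ((n.+1`! ^ k)%:R * (k ^ N)%:R) * z <= (k ^ k)%:R * N`!%:R :> R.
  rewrite -(@ler_pXn2r _ 2) ?nnegrE ?mulr_ge0 // ?(ltW z0) //.
  rewrite exprMn; set b := (k ^ k)%:R * _; set a := k`!%:R * _.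
  have -> : b ^+ 2 = b ^+ 2 * n.+1%:R ^+ K * z ^+ 2.
    by rewrite -mulrA [_ ^+ K * _]mulrC z2 mulr1.
  rewrite ler_wpM2r ?exprn_ge0 ?(ltW z0) // /a /b.
  by rewrite -!natrM -!natrX -natrM ler_nat; exact: multinomial_sq_ge.
have cnt : N`!%:R * (n.+1 ^ N.-1)%:R <= N%:R * A%:R * (k ^ K)%:R * (n.+1`! ^ k)%:R :> R.
  by rewrite -!natrM ler_nat; apply: card_splittable_trees_ge.
have N2 : (2 <= N)%N by rewrite /N /k; nia.
have NR : 0 < N%:R :> R by rewrite ltr0n; lia.
have Ne : N = (N - 2).+2 by lia.
move: (N - 2)%N Ne => e Ne.
have powE : (k ^ N)%:R * (n.+1 ^ N.-1)%:R = k%:R * N%:R * N%:R ^+ e :> R.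
  rewrite -natrX -!natrM [in (k ^ _)%N]Ne [in (n.+1 ^ _)%N]Ne /= /N expnMn !expnS.
  by congr (_%:R); move: (k ^ e)%N (n.+1 ^ e)%N => x y; ring.
have le1 : k`!%:R * z * k%:R * N%:R ^+ e <= (k ^ k * k ^ K)%:R * A%:R.
  rewrite -(ler_pM2l F0) -(ler_pM2l NR).
  apply: (@le_trans _ _ ((k ^ k)%:R * N`!%:R * (n.+1 ^ N.-1)%:R)).
    rewrite (le_trans _ (ler_wpM2r _ mult)) //.
    rewrite [leRHS](_ : _ = k`!%:R * (n.+1`! ^ k)%:R * z * ((k ^ N)%:R * (n.+1 ^ N.-1)%:R));
      last by ring.
    rewrite powE le_eqVlt; apply/orP; left; apply/eqP; ring.
  rewrite -mulrA; apply: le_trans (ler_wpM2l _ cnt) _ => //.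
  rewrite natrM le_eqVlt; apply/orP; left; apply/eqP; ring.
have D0 : 0 < (k ^ k * k ^ K)%:R :> R by rewrite ltr0n muln_gt0 !expn_gt0.
rewrite [leLHS](_ : _ = k`!%:R * z * N%:R ^+ e / (k ^ k * k ^ K)%:R); last first.
  by field; rewrite !pnatr_eq0 -!lt0n !expn_gt0.
rewrite ler_pdivrMr // [leRHS]mulrC; apply: le_trans le1.
by rewrite [leRHS]mulrAC ler_peMr ?ler1n // !mulr_ge0 ?exprn_ge0 // ltW.
Qed.

(** [e^(d n)] is the square of [e^(d n / 2)], hence at least [(d n / 2)^2], which is at least [n]
    once [n >= 4 / d^2]. *)
Lemma ln_le_linear (R : realType) (d : R) n : 0 < d -> (0 < n)%N ->
  4 / d ^+ 2 <= n%:R -> ln n%:R <= d * n%:R.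
Proof.
move=> d0 n0 dn; have nR : 0 < n%:R :> R by rewrite ltr0n.
have d2 : 0 < d ^+ 2 by rewrite exprn_gt0.
rewrite -ler_expR lnK ?posrE //.
have -> : d * n%:R = d * n%:R / 2 + d * n%:R / 2 by lra.
rewrite expRD -expr2.
apply: (@le_trans _ _ ((d * n%:R / 2) ^+ 2)).
  rewrite -(ler_pM2l (_ : 0 < 4 / d ^+ 2)) ?divr_gt0 //.
  have -> : 4 / d ^+ 2 * (d * n%:R / 2) ^+ 2 = n%:R * n%:R :> R.
    by field; rewrite gt_eqF.
  by rewrite ler_wpM2r // ltW.
rewrite lerXn2r ?nnegrE ?expR_ge0 ?divr_ge0 ?mulr_ge0 ?(ltW d0) //.
by apply: le_trans (expR_ge1Dx _); rewrite lerDr.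
Qed.

Unset Implicit Arguments.

Theorem theorem4 (R : realType) (k : nat) : (2 <= k)%N ->
  exists Ck : R, 0 < Ck /\
  forall c : R, 0 < c ->
  forall eps : R, 0 < eps ->
  exists n0 : nat, forall n m : nat,
    (n0 <= n)%N ->
    (m <= 'C(k * n, 2))%N ->
    c * ('C(k * n, 2))%:R / ln (n%:R : R) <= m%:R ->
    let p : R := m%:R / ('C(k * n, 2))%:R in
    Ck * (n%:R `^ ((1 - k%:R) / 2)) * p * expR (- (2 + eps) / p)
      <= prob_split R (k * n) k m.
Proof.
case: k => [//|K] K1; have K0 : (0 < K)%N by lia.
pose Ck : R := K.+1`!%:R / (K.+1 ^ K.+1 * K.+1 ^ K)%:R.
have Ck0 : 0 < Ck.
  by rewrite divr_gt0 // ltr0n ?fact_gt0 // muln_gt0 !expn_gt0.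
exists Ck; split=> // c c0 eps eps0.
(* From [m >= N B] follow both [2 N <= m] and [(2 + eps) N <= eps m]; the latter is what turns
   [2 M / (m - N)] into at most [(2 + eps) / p]. *)
pose B : R := 2 + 2 / eps; have B0 : 0 < B by rewrite addr_gt0 // divr_gt0.
(* Chosen so that [ln n <= d n] and [N n <= 2 M] turn the density hypothesis into [m >= N B]. *)
pose d : R := c / (2 * B); have d0 : 0 < d by rewrite divr_gt0 // mulr_gt0.
have [n1 n1P] : exists n1 : nat, 4 / d ^+ 2 <= n1%:R.
  exists (Num.bound (4 / d ^+ 2)); apply/ltW/archi_boundP.
  by rewrite divr_ge0 // exprn_ge0 // ltW.
exists (maxn 2 n1) => n m; rewrite geq_max => /andP[n2 nn1] mM mge /=.
set N := (K.+1 * n)%N in mM mge *; set M := 'C(N, 2) in mM mge *.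
set p : R := m%:R / M%:R.
have n_gt0 : (0 < n)%N := ltnW n2.
have N3 : (n < N)%N by rewrite /N -[X in (X < _)%N]mul1n ltn_pmul2r.
have N_gt0 : (0 < N)%N := leq_ltn_trans (leq0n n) N3.
have N2 : (2 <= N)%N := leq_ltn_trans n_gt0 N3.
have n0 : 0 < n%:R :> R by rewrite ltr0n.
have NR : 0 < N%:R :> R by rewrite ltr0n.
have M0 : (0 < M)%N by rewrite bin_gt0.
have MR : 0 < M%:R :> R by rewrite ltr0n.
have ln0 : 0 < ln (n%:R : R) by rewrite ln_gt0 // ltr1n.
have lnd : ln (n%:R : R) <= d * n%:R.
  apply: ln_le_linear => //.
  by apply: (le_trans n1P); rewrite ler_nat.
have ME : 2 * M%:R = N%:R * (N%:R - 1) :> R.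
  have e2 : (N * N.-1 = 2 * M)%N by rewrite -(bin1 N.-1) mul_bin_diag.
  have NE : N%:R - 1 = N.-1%:R :> R by rewrite -{1}(prednK N_gt0) -natr1 addrK.
  by rewrite NE -!natrM e2.
have mB : N%:R * B <= m%:R.
  apply: le_trans mge; rewrite ler_pdivlMr //.
  apply: le_trans (ler_wpM2l _ lnd) _; first by rewrite mulr_ge0 ?ltW.
  have -> : N%:R * B * (d * n%:R) = c * (N%:R * n%:R) / 2.
    by rewrite /d; field; rewrite gt_eqF.
  have : N%:R * n%:R <= 2 * M%:R :> R.
    by rewrite ME ler_wpM2l ?(ltW NR) // lerBrDr natr1 ler_nat.
  nra.
have epsB : eps * B = 2 * eps + 2 by rewrite /B; field; rewrite gt_eqF.
have mN2 : (2 * N <= m)%N.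
  rewrite -(ler_nat R) natrM; apply: le_trans mB.
  by rewrite mulrC ler_wpM2l ?(ltW NR) // /B lerDl divr_ge0 // ltW.
have Nm : (N < m)%N by apply: leq_trans mN2; rewrite ltn_Pmull.
have mNR : 0 < m%:R - N%:R :> R by rewrite subr_gt0 ltr_nat.
have mR : 0 < m%:R :> R by rewrite ltr0n (leq_ltn_trans _ Nm).
have mMR : m%:R <= M%:R :> R by rewrite ler_nat.
pose x : R := M%:R / (m%:R - N%:R).
have x1 : 1 <= x by rewrite ler_pdivlMr // mul1r; lra.
pose W : R := N%:R ^+ (N - 2) * expR (2 * x).
have W0 : 0 < W by rewrite mulr_gt0 ?exprn_gt0 ?expR_gt0.
have p0 : 0 < p by rewrite divr_gt0.
have p1 : p <= 1 by rewrite ler_pdivrMr // mul1r.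
have xp : 2 * x <= (2 + eps) / p.
  rewrite /x /p invf_div !mulrA ler_pdivrMr // mulrAC ler_pdivlMr //.
  rewrite mulrAC [leRHS]mulrAC ler_wpM2r ?(ltW MR) //.
  have : eps * (N%:R * B) <= eps * m%:R by rewrite ler_wpM2l // ltW.
  rewrite mulrCA epsB; nra.
have : #|splittable_trees N K.+1|%:R / W <= prob_split R N K.+1 m.
  apply: mean_split_ratio_ge => // T tT.
  exact: tree_overlap_sum_le.
apply: le_trans; rewrite ler_pdivlMr //.
apply: le_trans (card_splittable_trees_ge_powR R K0 n_gt0).
set z := n%:R `^ _; have z0 : 0 < z by rewrite powR_gt0.
rewrite -/Ck; clearbody p z.
(* The inserted 1 is to be compared with [p <= 1], and the exponential with the target through
   [xp]. *)
have -> : Ck * z * N%:R ^+ (N - 2) = Ck * z * 1 * expR (- (2 * x)) * W.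
  by rewrite mulr1 /W -(mulrA (Ck * z)) [expR _ * (_ * _)]mulrCA -expRD addNr expR0 mulr1.
rewrite ler_wpM2r ?(ltW W0) //.
apply: ler_pM; rewrite ?expR_ge0 // ?ler_expR ?mulNr ?lerN2 //.
  by rewrite !mulr_ge0 ?(ltW Ck0) ?(ltW z0) ?(ltW p0).
by apply: ler_wpM2l => //; rewrite mulr_ge0 ?(ltW Ck0) ?(ltW z0).
Qed.
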